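(* Let $f=q\ast W:\mathbb{R}^d\to\mathbb{R}$ satisfy Assumption A (stated in the context). Then for all $\ell<-\ell_c$ the probability that $\Lambda_1$ intersects a bounded component of $\{f\ge\ell\}$ of large diameter decays super-polynomially, i.e. for every $j\in\mathbb{N}$ $$n^j\cdot\mathbb{P}\Big(\Lambda_1\overset{\{f\ge\ell\}_{<\infty}}{\longleftrightarrow}\partial\Lambda_n\Big)\to0\qquad\text{as }n\to\infty.$$ In particular, if $d=2$, this holds for the entire supercritical regime $\ell<\ell_c=0$.
   Context: Let $d\ge2$. A Gaussian white noise on $\mathbb{R}^d$ is a centred Gaussian process $W$ indexed by $L^2(\mathbb{R}^d)$ with $\mathbb{E}[W(g)W(h)]=\int gh\,dx$. The field $f:\mathbb{R}^d\to\mathbb{R}$ is a stationary Gaussian field with mean zero, variance one and continuous covariance $K(x-y)=\mathbb{E}[f(x)f(y)]$, given by $f(x)=(q\ast W)(x)=\int q(x-y)\,W(dy)$, where $q\in L^2(\mathbb{R}^d)$ and $q(x)=q(-x)$; so $K=q\ast q$. Assumption A (with parameters $k,\beta$): (1) $K\in C^{2k+\epsilon}$ for some integer $k\ge4$ and some $\epsilon>0$ (so $f$ is $C^k$ almost surely); (2) $q\in C^3(\mathbb{R}^d)$ and $\partial^\alpha q\in L^2(\mathbb{R}^d)$ for all $|\alpha|\le3$; (3) there exist $\beta>d$ and $c\ge1$ such that $\max_{|\alpha|\le2}|\partial^\alpha q(x)|<c|x|^{-\beta}$ for all $|x|\ge1$; (4) $q(x)$ is invariant under sign changes and permutations of the coordinates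 of $x$; (5) if $d=2$ then $K=q\ast q\ge0$, and if $d\ge3$ then $q\ge0$. Notation: $\Lambda_n=[-n,n]^d$; $\{f\ge\ell\}=\{x:f(x)\ge\ell\}$; $\{f\ge\ell\}_\infty$ is the union of all unbounded connected components of $\{f\ge\ell\}$ and $\{f\ge\ell\}_{<\infty}=\{f\ge\ell\}\setminus\{f\ge\ell\}_\infty$. For sets $A,B,C$, $A\overset{B}{\longleftrightarrow}C$ is the event that there is a continuous curve in $B$ starting in $A$ and ending in $C$. Critical level (known fact): under Assumption A there is $\ell_c\in\mathbb{R}$ such that for each $\ell>\ell_c$ there are $C,c>0$ with $\mathbb{P}(\Lambda_1\overset{\{f\ge\ell\}}{\longleftrightarrow}\partial\Lambda_n)<Ce^{-cn}$ for all $n>2$, and for each $\ell<\ell_c$ there are $C,c>0$ with $\mathbb{P}(\Lambda_n\cap\{f\ge\ell\}_\infty=\emptyset)<Ce^{-cn^{d-1}}$ for all $n>2$; moreover for $\ell<\ell_c$ almost surely $\{f\ge\ell\}$ has exactly one unbounded component. If $d=2$ then $\ell_c=0$. *)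

(* Defs.v *)
From HB Require Import structures.
From mathcomp Require Import all_boot all_order all_algebra perm.
From mathcomp Require Import all_classical all_reals all_analysis.

Set Implicit Arguments.
Unset Strict Implicit.
Unset Printing Implicit Defensive.
Import Order.TTheory GRing.Theory Num.Theory.
Import numFieldNormedType.Exports.
Local Open Scope classical_set_scope.
Local Open Scope ring_scope.

Section LebesgueRd.
Variable R : realType.
Local Notation mR := (measurableTypeR R).

Definition cons_pair n (p : mR * n.-tuple mR) : n.+1.-tuple mR :=
  [tuple of p.1 :: p.2].

Lemma measurable_cons_pair n : measurable_fun setT (@cons_pair n).
Proof.
by apply: measurable_cons; [exact: measurable_fst|exact: measurable_snd].
Qed.

Section lebesgue_cons.
Variables (n : nat) (mu : {sigma_finite_measure set (n.-tuple mR) -> \bar R}).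

Definition lebesgue_cons : set (n.+1.-tuple mR) -> \bar R :=
  pushforward (@lebesgue_measure R \x mu)%E (@cons_pair n).

Let lebesgue_cons0 : lebesgue_cons set0 = 0%E.
Proof. by rewrite /lebesgue_cons /pushforward preimage_set0 measure0. Qed.

Let lebesgue_cons_ge0 A : (0 <= lebesgue_cons A)%E.
Proof. by rewrite /lebesgue_cons /pushforward; exact: measure_ge0. Qed.

Let lebesgue_cons_sigma_additive : semi_sigma_additive lebesgue_cons.
Proof.
move=> F mF tF mUF; rewrite /lebesgue_cons /pushforward preimage_bigcup.
have mpre B : measurable B -> measurable (@cons_pair n @^-1` B).
  by move=> mB; rewrite -[X in measurable X]setTI; exact: measurable_cons_pair.
apply: measure_semi_sigma_additive.
- by move=> i; exact: mpre (mF i).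
- apply/trivIsetP => /= i j _ _ ij; rewrite -preimage_setI.
  by move/trivIsetP : tF => /(_ _ _ _ _ ij) ->//; rewrite preimage_set0.
- by rewrite -preimage_bigcup; exact: mpre.
Qed.

HB.instance Definition _ := isMeasure.Build _ _ _ lebesgue_cons
  lebesgue_cons0 lebesgue_cons_ge0 lebesgue_cons_sigma_additive.

Lemma lebesgue_consE (A : set mR) (B : set (n.-tuple mR)) :
  measurable A -> measurable B ->
  lebesgue_cons [set t | A (thead t) /\ B [tuple of behead t]] =
  (lebesgue_measure A * mu B)%E.
Proof.
move=> mA mB; rewrite /lebesgue_cons /pushforward -product_measure1E//.
congr (_ \x _)%E; apply/seteqP.
have tlK (p : mR * n.-tuple mR) : [tuple of behead (cons_pair p)] = p.2.
  exact/val_inj.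
by split=> -[x t] /=; rewrite tlK.
Qed.

Let lebesgue_cons_sigma_finite : sigma_finite setT lebesgue_cons.
Proof.
have /sigma_finiteP[F [TF ndF Foo]] := sigma_finiteT (@lebesgue_measure R).
have /sigma_finiteP[G [TG ndG Goo]] := sigma_finiteT mu.
exists (fun k => [set t | F k (thead t) /\ G k [tuple of behead t]]).
  apply/esym; rewrite -subTset => t _.
  have [a _ Fa] : (\bigcup_k F k) (thead t) by rewrite -TF.
  have [b _ Gb] : (\bigcup_k G k) [tuple of behead t] by rewrite -TG.
  exists (maxn a b) => //; split.
    by move: (thead t) Fa; exact/subsetPset/ndF/leq_maxl.
  by move: [tuple of behead t] Gb; exact/subsetPset/ndG/leq_maxr.
move=> k; have [mF Fk] := Foo k; have [mG Gk] := Goo k; split.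
  apply: measurableI; rewrite -[X in measurable X]setTI.
    exact: (@measurable_tnth _ mR n.+1 ord0).
  exact: (@measurable_behead _ mR n).
by rewrite lebesgue_consE// lte_mul_pinfty// ge0_fin_numE.
Qed.

HB.instance Definition _ := Measure_isSigmaFinite.Build _ _ _ lebesgue_cons
  lebesgue_cons_sigma_finite.

End lebesgue_cons.

Fixpoint lebesgueRd d : {sigma_finite_measure set (d.-tuple mR) -> \bar R} :=
  match d with
  | 0 => @dirac _ _ [tuple] R
  | d'.+1 => lebesgue_cons (lebesgueRd d')
  end.

Lemma lebesgueRd_prod d (A : 'I_d -> set mR) : (forall i, measurable (A i)) ->
  lebesgueRd d [set t | forall i, A i (tnth t i)] =
  (\prod_(i < d) lebesgue_measure (A i))%E.
Proof.
elim: d A => [|d IH] A mA.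
  rewrite big_ord0 /= diracE (_ : [tuple] \in _)//.
  by rewrite inE /= => -[].
have mB (i : 'I_d) : measurable (A (lift ord0 i)) by exact: mA.
rewrite big_ord_recl -(IH _ mB) -lebesgue_consE//; last first.
  rewrite (_ : [set _ | _] = \bigcap_(i in [set: 'I_d])
      ((fun t : d.-tuple mR => tnth t i) @^-1` A (lift ord0 i))); last first.
    by apply/seteqP; split=> t /= At i => [_|]; exact: At.
  apply: fin_bigcap_measurable => [|i _]; first exact: finite_finset.
  by rewrite -[X in measurable X]setTI; exact: measurable_tnth.
congr (lebesgue_cons _ _); apply/seteqP; split=> t /=.
  move=> At; split=> [|i]; first exact: At.
  by have := At (lift ord0 i); rewrite [in tnth t _](tuple_eta t) tnthS.
move=> [A0 At] i; case: (unliftP ord0 i) => [j|] -> //.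
by rewrite [in tnth t _](tuple_eta t) tnthS; exact: At.
Qed.

End LebesgueRd.

Section Analysis.
Variables (R : realType) (d : nat).
Implicit Types (g h q : 'rV[R]_d -> R) (x y : 'rV[R]_d).

Definition enorm x : R := Num.sqrt (\sum_(i < d) x 0 i ^+ 2).

Definition vec (t : d.-tuple (measurableTypeR R)) : 'rV[R]_d :=
  \row_i tnth t i.

Definition L2 g : Prop := (g \o vec) \in Lfun (lebesgueRd R d) 2%:E.

Definition integralRd g : R := \int[lebesgueRd R d]_t g (vec t).

Definition convolution g h x : R := integralRd (fun y => g (x - y) * h y).

Definition pderiv (i : 'I_d) g : 'rV[R]_d -> R :=
  fun x => 'D_(delta_mx 0 i) g x.

Definition mderiv (al : 'I_d -> nat) g : 'rV[R]_d -> R :=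
  foldr (fun i h => iter (al i) (pderiv i) h) g (enum 'I_d).

Definition morder (al : 'I_d -> nat) : nat := (\sum_(i < d) al i)%N.

Fixpoint Cn (m : nat) g : Prop :=
  match m with
  | 0 => continuous g
  | m'.+1 => continuous g /\ forall i : 'I_d,
      (forall x, derivable g x (delta_mx 0 i)) /\ Cn m' (pderiv i g)
  end.

(* The class C^s for real s >= 0: with m the integer part of s, g is C^m and
   its derivatives of order m are locally (s - m)-Hoelder. *)
Definition holder_class (s : R) g : Prop :=
  let m := Num.truncn s in
  Cn m g /\
  forall al, morder al = m -> forall M : R, exists C : R,
  forall x y, enorm x <= M -> enorm y <= M ->
    `|mderiv al g x - mderiv al g y| <= C * enorm (x - y) `^ (s - m%:R).

Record assumptionA (k : nat) (beta : R) q : Prop := AssumptionA {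
  A_smooth_cov : (4 <= k)%N /\
    exists2 eps : R, 0 < eps &
      holder_class ((2 * k)%N%:R + eps) (convolution q q);
  A_smooth_kernel : Cn 3 q /\
    forall al, (morder al <= 3)%N -> L2 (mderiv al q);
  A_decay : d%:R < beta /\
    exists2 c : R, 1 <= c &
      forall al x, (morder al <= 2)%N -> 1 <= enorm x ->
        `|mderiv al q x| < c * enorm x `^ (- beta);
  A_sign_changes : forall (s : 'I_d -> bool) x,
    q (\row_i ((-1) ^+ s i * x 0 i)) = q x;
  A_permutations : forall (s : 'S_d) x, q (col_perm s x) = q x;
  A_positive : (d = 2%N -> forall x, 0 <= convolution q q x) /\
    ((3 <= d)%N -> forall x, 0 <= q x)
}.

End Analysis.

Section GaussianFields.
Variables (R : realType) (d : nat).
Context (disp : measure_display) (T : measurableType disp).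
Variable P : probability T R.

(* normal_prob 0 0 is the uniform law on [0, 1] by convention, hence the case
   distinction: the degenerate centred Gaussian law is the Dirac mass at 0. *)
Definition centred_gaussian (X : T -> R) : Prop :=
  measurable_fun setT X /\
  exists sigma : R, forall A : set (measurableTypeR R), measurable A ->
    P (X @^-1` A) = if sigma == 0 then \d_(0 : R) A else normal_prob 0 sigma A.

(* W g is only meaningful for g in L^2; W is a centred Gaussian process when
   every finite linear combination of its values is centred Gaussian. *)
Record white_noise (W : ('rV[R]_d -> R) -> T -> R) : Prop := WhiteNoise {
  white_noise_gaussian : forall (m : nat) (g : 'I_m -> 'rV[R]_d -> R)
      (a : 'I_m -> R), (forall i, L2 (g i)) ->
    centred_gaussian (fun w => \sum_(i < m) a i * W (g i) w);
  white_noise_cov : forall g h : 'rV[R]_d -> R, L2 g -> L2 h ->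
    expectation P (fun w => W g w * W h w) = (integralRd (fun x => g x * h x))%:E
}.

(* f = q * W.  The identity f(x) = W(q(x - .)) holds almost surely for each
   fixed x, so it determines f up to modification; as usual f is the version
   with (almost surely) continuous sample paths. *)
Record moving_average (W : ('rV[R]_d -> R) -> T -> R) (q : 'rV[R]_d -> R)
    (f : T -> 'rV[R]_d -> R) : Prop := MovingAverage {
  kernel_L2 : L2 q;
  kernel_even : forall x, q (- x) = q x;
  field_measurable : forall x, measurable_fun setT (f ^~ x);
  field_conv : forall x, {ae P, forall w, f w x = W (fun y => q (x - y)) w};
  field_variance : forall x, variance P (f ^~ x) = 1%E;
  field_continuous : {ae P, forall w, continuous (f w)}
}.

End GaussianFields.

Section Percolation.
Variables (R : realType) (d : nat).
Implicit Types A B C : set 'rV[R]_d.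

Definition Lambda (n : nat) : set 'rV[R]_d :=
  [set x | forall i, - n%:R <= x 0 i <= n%:R].

Definition boundary A : set 'rV[R]_d := closure A `\` interior A.

Definition excursion (u : 'rV[R]_d -> R) (l : R) : set 'rV[R]_d :=
  [set x | l <= u x].

Definition unbounded_part A : set 'rV[R]_d :=
  \bigcup_(C in [set C | (connected_component A @` A) C /\ ~ bounded_set C]) C.

Definition bounded_part A : set 'rV[R]_d := A `\` unbounded_part A.

Definition joined A B C : Prop :=
  exists gam : R -> 'rV[R]_d,
    [/\ {within `[0, 1], continuous gam},
        (forall t : R, 0 <= t <= 1 -> B (gam t)), A (gam 0) & C (gam 1)].

Context (disp : measure_display) (T : measurableType disp).
Variables (P : probability T R) (f : T -> 'rV[R]_d -> R).

(* The connection events need not belong to the sigma-algebra of T, on which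
   no completeness is assumed, and P is unspecified on non-measurable sets.
   Their probability is therefore the outer probability P^*, which extends P
   and its completion. *)
Definition prob (E : set T) : \bar R := (P^* E)%mu.

Definition critical_level (lc : R) : Prop :=
  (forall l, lc < l -> exists C c : R, [/\ 0 < C, 0 < c &
     forall n : nat, (2 < n)%N ->
       (prob [set w | joined (Lambda 1) (excursion (f w) l)
                             (boundary (Lambda n))]
        < (C * expR (- c * n%:R))%:E)%E]) /\
  (forall l, l < lc -> exists C c : R, [/\ 0 < C, 0 < c &
     forall n : nat, (2 < n)%N ->
       (prob [set w | Lambda n `&` unbounded_part (excursion (f w) l) = set0]
        < (C * expR (- c * n%:R ^+ d.-1))%:E)%E]).

Definition superpolynomial_decay (l : R) : Prop :=
  forall j : nat,
    ((n%:R ^+ j)%:E *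
      prob [set w | joined (Lambda 1) (bounded_part (excursion (f w) l))
                           (boundary (Lambda n))])%E @[n --> \oo] --> 0%E.

End Percolation.

(* Main.v *)
Require Import Defs.
From HB Require Import structures.
From mathcomp Require Import all_boot all_order all_algebra.
From mathcomp Require Import all_classical all_reals all_analysis.
From mathcomp Require Import measurable_realfun ring lra.

Set Implicit Arguments.
Unset Strict Implicit.
Unset Printing Implicit Defensive.
Import Order.TTheory GRing.Theory Num.Theory.
Import numFieldNormedType.Exports.
Local Open Scope classical_set_scope.
Local Open Scope ring_scope.

(** A bounded cluster of [{f >= l}] that contains a curve from [Lambda 1] to
    distance [n] is surrounded by [{f < l}].  Instead of using that the outer
    boundary of the cluster is connected, consider the half-lines issued from
    the starting point of the curve, rotating from direction [-E] to direction
    [E], followed by the half-lines of direction [E] issued from the successive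
    points of the curve, where [E] is the coordinate direction in which the
    curve reaches distance [n].  This is a map from a square: its bottom side is
    sent into the cluster and its top side far away, so that a parity argument
    on a fine grid gives a crossing from left to right inside [{f < l}].  It
    joins a point at distance about [t] behind the start of the curve to a point
    at distance at least [n + t] from it, for some [t >= 0].

    Since [f (. + z)] and [- f] have the same law, such a connection costs at
    most [C exp (- c (n + t))] when [- l > lc], and a union bound over the integer
    part of [t] and over the [2d] directions gives exponential decay.  Connection
    events are replaced by the existence of finite chains of rational balls, which
    are measurable functions of the values of [f] at rational points; the equality
    of laws is the Cramer-Wold device together with the fact that centred Gaussian
    variables with the same second moment have the same law. *)

(** * Crossings of bounded clusters *)

(** Read [V] as lying near the cluster and [L] as being joined to the left side. The number of
    vertical edges of a column along which [V] changes and whose lower end satisfies [L] has the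
    same parity in all columns, because a mixed cell carries a single value of [L]. It is odd in
    column 0, hence nonzero in column [n]. *)
Lemma grid_crossing (n m : nat) (V L : nat -> nat -> bool) :
  (forall i, (i <= n)%N -> V i 0%N) ->
  (forall i, (i <= n)%N -> ~~ V i m) ->
  (forall j, (j < m)%N -> V 0%N j != V 0%N j.+1 -> L 0%N j) ->
  (forall i j, (i < n)%N -> (j < m)%N ->
     ~~ [&& V i j == V i.+1 j, V i j == V i j.+1 & V i j == V i.+1 j.+1] ->
     [&& L i j == L i.+1 j, L i j == L i j.+1 & L i j == L i.+1 j.+1]) ->
  exists2 j, (j < m)%N & (V n j != V n j.+1) && L n j.
Proof.
move=> Vbot Vtop Lleft Lsq.
pose vert i j := (V i j (+) V i j.+1) && L i j.
pose hori i j := (V i j (+) V i.+1 j) && L i j.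
pose par i k := odd (\sum_(j < k) vert i j).
have parS i k : par i k.+1 = par i k (+) vert i k.
  by rewrite /par big_ord_recr /= oddD oddb.
have par00 i : par i 0%N = false by rewrite /par big_ord0.
clearbody par.
(* Summing over the cells between columns [i] and [i.+1] below height [k] leaves only the horizontal
   edges at heights 0 and [k]. At height [m] that term vanishes whatever [L] is, since [V] is false
   there. *)
have strip i k : (i < n)%N -> (k <= m)%N ->
    par i k (+) par i.+1 k = hori i 0%N (+)
      (if (k < m)%N then hori i k else (V i k (+) V i.+1 k) && L i k.-1).
  move=> ilt; have Vt := negbTE (Vtop i (ltnW ilt)).
  have Vt1 := negbTE (Vtop i.+1 ilt).
  elim: k => [|k IHk] km.
    rewrite !par00; case: ltnP => [_|m0] /=; first by rewrite addbb.
    by rewrite /hori /= addbb.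
  rewrite (parS i k) (parS i.+1 k) addbACA.
  have := IHk (ltnW km); rewrite km => ->; rewrite -addbA; congr (_ (+) _).
  rewrite /hori /vert; set a := V i k; set b := V i.+1 k; set c := V i k.+1.
  set e := V i.+1 k.+1.
  have -> : (if (k.+1 < m)%N then (c (+) e) && L i k.+1
    else (c (+) e) && L i k.+1.-1) = (c (+) e) && L i k.+1.
    have [//|mk] := ltnP k.+1 m.
    have ek : k.+1 = m by apply/eqP; rewrite eqn_leq km mk.
    by rewrite /c /e ek Vt Vt1.
  (* In a cell with constant [V] every term vanishes; in a mixed cell [L] factors out and the
     changes of [V] round the cell cancel. *)
  have := Lsq i k ilt km; rewrite -/a -/b -/c -/e.
  have [/and3P[/eqP <- /eqP <- /eqP <-] _|_ /(_ isT)] := boolP [&& _, _ & _].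
    by rewrite addbb.
  move=> /and3P[/eqP <- /eqP <- _]; rewrite -!andb_addl.
  by case: a b c e => [] [] [] [].
have parC i : (i < n)%N -> par i m = par i.+1 m.
  move=> ilt; have := strip i m ilt (leqnn _); rewrite ltnn /hori.
  rewrite (Vbot _ (ltnW ilt)) (Vbot _ ilt) (negbTE (Vtop _ (ltnW ilt))).
  by rewrite (negbTE (Vtop _ ilt)) /=; case: (par i m); case: (par i.+1 m).
(* On the left side every change of [V] is counted, so the parity telescopes to the difference
   between the bottom and top values of [V]. *)
have par0 : par 0%N m.
  have leftE k : (k <= m)%N -> par 0%N k = V 0%N 0%N (+) V 0%N k.
    elim: k => [|k IHk] km; first by rewrite par00 addbb.
    rewrite parS (IHk (ltnW km)) /vert; have := Lleft k km.
    case: eqVneq => [-> _|ne /(_ isT) ->].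
      by rewrite addbb addbF.
    by rewrite andbT addbA addbK.
  by rewrite (leftE m (leqnn m)) (Vbot _ (leq0n n)) (negbTE (Vtop _ (leq0n n))).
have parn i : (i <= n)%N -> par i m.
  by elim: i => // i IHi ilt; rewrite -parC// IHi// ltnW.
apply/exists2P; apply: contrapT => noj; have := parn n (leqnn n).
have parP k : (k <= m)%N -> par n k -> exists2 j, (j < k)%N & vert n j.
  elim: k => [|k IHk] km; first by rewrite par00.
  rewrite parS; case vk: (vert n k); first by exists k.
  by rewrite addbF => /IHk[|j jk vj]; [exact: ltnW|exists j => //; exact: ltnW].
move=> /(parP m (leqnn m))[j jm vj]; apply: noj; exists j; split => //.
by move: vj; rewrite /vert; case: (V _ _); case: (V _ _).
Qed.

(** * Components of compact sets through chains of small jumps *)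

Section ChainComponents.
Variables (R : realType) (V : normedModType R).
Implicit Types (A X : set V) (x y : V) (e : R).

(** The points reached from [x] by finitely many jumps shorter than [e] inside [X], encoded as the
    least set stable under such jumps, so that no list of points is handled. *)
Definition chain_component X e x : set V :=
  [set y | X y /\ forall S : set V, S x ->
     (forall a b, S a -> X b -> `|a - b| < e -> S b) -> S y].

Lemma chain_component_refl X e x : X x -> chain_component X e x x.
Proof. by []. Qed.

Lemma chain_component_step X e x a b :
  chain_component X e x a -> X b -> `|a - b| < e -> chain_component X e x b.
Proof. by move=> [_ aS] Xb ab; split=> // S Sx Se; exact: Se (aS _ Sx Se) _ _. Qed.

Lemma le_chain_component X e e' x : e <= e' ->
  chain_component X e x `<=` chain_component X e' x.
Proof.
move=> ee' y [Xy yS]; split=> // S Sx Se; apply: yS => // a b Sa Xb ab.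
exact: Se Sa Xb (lt_le_trans ab ee').
Qed.

Lemma nbhs_chain_componentC X e x y : 0 < e -> X y ->
  ~ chain_component X e x y ->
  \forall z \near y, ~ chain_component X e x z.
Proof.
move=> e0 Xy ny; near=> z => cz; apply: ny; apply: chain_component_step cz Xy _.
rewrite distrC; near: z; exact: cvgr_dist_lt.
Unshelve. all: by end_near. Qed.

(** The joint neighbourhood in [z] and [n] is the form required by the near-covering
    characterisation of compactness. *)
Lemma near_chain_componentC X x y : X y ->
  ~ (forall n, chain_component X n.+1%:R^-1 x y) ->
  \forall z \near y & n \near \oo, ~ chain_component X n.+1%:R^-1 x z.
Proof.
move=> Xy /existsNP[m nm].
exists ([set z | ~ chain_component X m.+1%:R^-1 x z], [set n | (m <= n)%N]) => /=.
  split; last by exists m.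
  by apply: nbhs_chain_componentC => //; rewrite invr_gt0.
move=> [z n] /= [nz mn] cz; apply: nz; apply: le_chain_component cz.
by rewrite lef_pV2 ?posrE// ler_nat.
Qed.

(** If the set split into two disjoint closed pieces, a Urysohn function would be 0 on the piece of
    [x] and 1 on the other; by compactness, chains with small enough jumps cannot pass from values
    below 1/2 to values above. *)
Lemma chain_components_connected X x : compact X -> closed X -> X x ->
  connected [set y | forall n, chain_component X n.+1%:R^-1 x y].
Proof.
move=> cX clX Xx; set D := [set y | _].
have clD : closed D.
  move=> y Dy; have Xy : X y.
    apply: clX => B /Dy[z [Dz Bz]]; exists z; split=> //.
    by have [] := Dz 0%N.
  move=> n; apply: contrapT => /(nbhs_chain_componentC _ Xy)/=.
  rewrite invr_gt0 ltr0n => /(_ isT)/Dy[z [Dz]]; apply; exact: Dz.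
have key P Q : closed P -> closed Q -> P `&` Q = set0 -> D = P `|` Q -> P x ->
    Q = set0.
  move=> clP clQ PQ0 DE Px.
  have [phi [cphi _ phiP phiQ]] : exists f : V -> R, [/\ continuous f,
      range f `<=` `[0, 1], f @` P `<=` [set 0] & f @` Q `<=` [set 1]].
    by apply/uniform_separatorP; apply: normal_uniform_separator => //;
       exact: pseudometric_normal.
  have D01 y : D y -> phi y = 0 \/ phi y = 1.
    by rewrite DE => -[Py|Qy]; [left; apply: phiP|right; apply: phiQ]; exists y.
  have /compact_near_coveringP cov := cX.
  (* Three local cases: off [D] fine chains from [x] do not arrive; where [phi] is 0, short jumps
     keep it below 1/2; where [phi] is 1, the premise [phi y < 2^-1] fails. *)
  have : \forall n \near \oo, X `<=` (fun y =>
      chain_component X n.+1%:R^-1 x y -> phi y < 2^-1 ->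
      forall b, `|y - b| < n.+1%:R^-1 -> phi b < 2^-1).
    apply: (cov nat \oo (fun n y => chain_component X n.+1%:R^-1 x y ->
      phi y < 2^-1 -> forall b, `|y - b| < n.+1%:R^-1 -> phi b < 2^-1)) => y Xy.
    have [Dy|nDy] := pselect (D y); last first.
      apply: filterS (near_chain_componentC Xy nDy) => -[z n] /= nz /nz.
      by case.
    have [phiy|phiy] := D01 y Dy.
      have : \forall z \near y, phi z < 2^-1.
        by apply: (cvgr_lt (phi y) (cphi y)); rewrite phiy invr_gt0.
      move=> /nbhs_normP[r /= r0 yr]; near=> z n => /= _ _ b zb.
      apply: yr => /=; rewrite -(subrKA z) (le_lt_trans (ler_normD _ _))//.
      rewrite [r]splitr ltrD//; first by near: z; apply: cvgr_dist_lt => //;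
        rewrite divr_gt0.
      apply: lt_trans zb _; near: n; exact: near_infty_natSinv_lt (PosNum
        (divr_gt0 r0 (ltr0n _ 2))).
    near=> z n => /= _ phiz; exfalso; move: phiz; apply/negP; rewrite -leNgt ltW//.
    near: z; apply: (cvgr_gt (phi y) (cphi y)).
    by rewrite phiy invf_lt1 ?ltr1n.
  move=> [n _ /(_ n (leqnn n)) step].
  rewrite -subset0 => q Qq; have /(_ n)[Xq Sq] : D q by rewrite DE; right.
  have [|a b [ca phia] Xb ab|cq] := Sq [set y |
    chain_component X n.+1%:R^-1 x y /\ phi y < 2^-1].
  - by split=> //; rewrite (phiP (phi x)) ?invr_gt0 //; exists x.
  - split; first exact: chain_component_step ca Xb ab.
    by apply: step ab => //; case: ca.
  - by rewrite (phiQ (phi q)) ?ltNge ?invf_le1 ?ler1n//; exists q.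
have Dx : D x by [].
(* A nonempty relatively clopen [B] and its complement cut [D] into two closed pieces; [key] empties
   the one that misses [x]. *)
move=> B [b Bb] [U oU BU] [Z cZ BZ]; rewrite eqEsubset.
split; first by rewrite BU; exact: subIsetl.
have DU : closed (D `&` ~` U) by apply: closedI => //; exact: open_closedC.
have DZ : closed (D `&` Z) by apply: closedI.
have dis : (D `&` Z) `&` (D `&` ~` U) = set0.
  by rewrite -BZ BU -subset0 => y [[_ Uy] [_ ]].
have cover : D = (D `&` Z) `|` (D `&` ~` U).
  by rewrite -BZ BU -setIUr setUv setIT.
have [Bx|nBx] := pselect (B x).
  have /seteqP[+ _] := key _ _ DZ DU dis cover (eq_ind _ (fun s => s x) Bx _ BZ).
  move=> D0 y Dy; apply: contrapT => nBy; apply: (D0 y); split=> // Uy.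
  by apply: nBy; rewrite BU.
have /seteqP[+ _] : D `&` Z = set0.
  apply: (key _ _ DU DZ); [by rewrite setIC|by rewrite setUC|].
  by split=> // Ux; apply: nBx; rewrite BU.
by rewrite -BZ => /(_ b Bb).
Unshelve. all: by end_near. Qed.

(* A Sura-Bura argument: in a compact space components are intersections of
   chain components, so some chain component stays as bounded as the component. *)
Lemma bounded_component_isolated A x :
  (forall B : set V, bounded_set B -> closed B -> compact B) ->
  closed A -> A x -> bounded_set (connected_component A x) ->
  exists K : set V, exists e : R,
    [/\ 0 < e, bounded_set K, connected_component A x `<=` K &
      forall a y, K y -> A a -> `|a - y| < e -> K a].
Proof.
move=> heine_borel clA Ax [M0 [_ bM]].
pose M := Num.max (M0 + 1) 1; have ltM : M0 < M by rewrite lt_max ltrDl ltr01.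
have compM y : connected_component A x y -> `|y| <= M by apply: bM.
(* The margin 2 leaves room: the component has norm at most [M], fine chains stay below [M + 1], and
   one more jump shorter than [e <= 1] cannot leave [X]. *)
pose X := A `&` [set y | `|y| <= M + 2].
have bX : bounded_set X.
  by exists (M + 2); split=> [|r Mr y [_ /= /le_trans]]; [exact: num_real|apply;
    exact: ltW].
have clX : closed X.
  apply: closedI => //; apply: closed_comp (@closed_le R (M + 2)) => y _.
  exact: norm_continuous.
have Xx : X x.
  by split=> //=; rewrite (le_trans (compM _ _)) ?lerDl//;
    exact: connected_component_refl.
have cX := heine_borel _ bX clX.
pose D := [set y | forall n, chain_component X n.+1%:R^-1 x y].
have cD : connected D by exact: chain_components_connected.
have DM y : D y -> `|y| <= M.
  move=> Dy; apply: compM; exists D => //; split=> // z.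
  by move=> /(_ 0%N)[[]].
have /compact_near_coveringP cov := cX.
have : \forall n \near \oo, X `<=` (fun y =>
    chain_component X n.+1%:R^-1 x y -> `|y| < M + 1).
  apply: (cov nat \oo (fun n y =>
    chain_component X n.+1%:R^-1 x y -> `|y| < M + 1)) => y Xy.
  have [Dy|nDy] := pselect (D y); last first.
    by apply: filterS (near_chain_componentC Xy nDy) => -[z n] /= nz /nz.
  near=> z n => /= _; near: z; apply: (cvgr_lt `|y|); first exact: norm_continuous.
  by rewrite (le_lt_trans (DM _ Dy))// ltrDl.
move=> [n _ /(_ n (leqnn n)) Kn]; set e : R := n.+1%:R^-1.
have e0 : 0 < e by rewrite invr_gt0.
have e1 : e <= 1 by rewrite invf_le1// ler1n.
have KM y : chain_component X e x y -> `|y| < M + 1.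
  by move=> Ky; apply: Kn => //; case: Ky.
have iso a y : chain_component X e x y -> A a -> `|a - y| < e ->
    chain_component X e x a.
  move=> Ky Aa ay; apply: (chain_component_step Ky); last by rewrite distrC.
  split=> //=; rewrite -(subrK y a) (le_trans (ler_normD _ _))//.
  rewrite addrC (_ : M + 2 = M + 1 + 1); last by rewrite -addrA.
  by rewrite lerD// ltW//; [exact: KM|exact: lt_le_trans ay e1].
exists (chain_component X e x), e; split => //.
  by exists (M + 1); split=> [|r Mr y /KM/ltW/le_trans]; [exact: num_real|apply;
    exact: ltW].
set C := connected_component A x.
have CA : C `<=` A by exact: connected_component_sub.
(* By isolation, the trace of the chain component on [C] is relatively clopen, and it contains
   [x]. *)
have <- : C `&` chain_component X e x = C; last by exact: subIsetr.
apply: (@component_connected _ A x).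
- by exists x; split; [exact: connected_component_refl|exact: chain_component_refl].
- exists (\bigcup_(y in chain_component X e x) ball y e).
    by apply: bigcup_open => y _; exact: ball_open.
  apply/seteqP; split=> y [Cy]; first by split=> //; exists y => //; exact: ballxx.
  move=> [z Kz]; rewrite -ball_normE /= distrC => yz; split=> //.
  by apply: iso Kz _ yz; exact: CA.
- exists (closure (chain_component X e x)); first exact: closed_closure.
  apply/seteqP; split=> y [Cy Ky]; split=> //; first exact: subset_closure.
  have /Ky[z [Kz]] : nbhs y (ball y e) by exact: nbhsx_ballx.
  by rewrite -ball_normE /=; apply: iso Kz _; exact: CA.
Unshelve. all: by end_near. Qed.

End ChainComponents.

Lemma compact_uniform_modulus (R : realType) (U V : normedModType R) (K : set U)
    (H : U -> V) (e : R) : compact K -> continuous H -> 0 < e ->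
  exists2 r : R, 0 < r & forall p p', K p -> `|p - p'| < r -> `|H p - H p'| < e.
Proof.
move=> /compact_near_coveringP cov cH e0.
have : \forall n \near \oo, K `<=` (fun p => forall p',
    `|p - p'| < n.+1%:R^-1 -> `|H p - H p'| < e).
  apply: (cov nat \oo (fun n p => forall p',
    `|p - p'| < n.+1%:R^-1 -> `|H p - H p'| < e)) => p Kp.
  have : \forall z \near p, `|H p - H z| < e / 2.
    by apply: cvgr_dist_lt; [exact: cH|rewrite divr_gt0].
  move=> /nbhs_normP[r /= r0 pr]; near=> z n => /= p' zp'.
  rewrite -(subrKA (H p)) (le_lt_trans (ler_normD _ _))// [e]splitr ltrD//.
    rewrite distrC; apply: pr => /=.
    rewrite (@lt_trans _ _ (r / 2)) ?ltr_pdivrMr ?ltr_pMr ?ltr1n//.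
    by near: z; apply: cvgr_dist_lt => //; rewrite divr_gt0.
  apply: pr => /=.
  rewrite -(subrKA z) (le_lt_trans (ler_normD _ _))// [r]splitr ltrD//.
    by near: z; apply: cvgr_dist_lt => //; rewrite divr_gt0.
  apply: lt_trans zp' _; near: n.
  exact: near_infty_natSinv_lt (PosNum (divr_gt0 r0 (ltr0n _ 2))).
move=> [n _ /(_ n (leqnn n)) Kn]; exists n.+1%:R^-1; first by rewrite invr_gt0.
by move=> p p' /Kn; apply.
Unshelve. all: by end_near. Qed.

Lemma connected_component_image (U V : topologicalType) (A : set U) (B : set V)
    (h : U -> V) x y : continuous h -> (forall z, A z -> B (h z)) ->
  connected_component A x y -> connected_component B (h x) (h y).
Proof.
move=> ch AB [S [Sx SA cS] Sy]; exists (h @` S); last by exists y.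
split; [by exists x|by move=> _ [z Sz <-]; exact/AB/SA|].
by apply: connected_continuous_connected => //; exact: continuous_subspaceT.
Qed.

(** The retraction of the line onto the unit interval: composing with it turns a curve continuous
    within the interval into a map continuous everywhere. *)
Definition clamp01 (R : realType) (s : R) : R := Num.min (Num.max s 0) 1.

Lemma clamp01_itv (R : realType) (s : R) : 0 <= clamp01 s <= 1.
Proof. by rewrite /clamp01 le_min le_max lexx orbT ler01 ge_min lexx orbT. Qed.

Lemma clamp01_id (R : realType) (s : R) : 0 <= s <= 1 -> clamp01 s = s.
Proof. by move=> /andP[s0 s1]; rewrite /clamp01 (max_idPl s0) (min_idPl s1). Qed.

Lemma continuous_clamp01 (R : realType) : continuous (@clamp01 R).
Proof.
move=> s; apply: (@continuous_min R R (fun s => Num.max s 0) (cst 1)).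
  by apply: (@continuous_max R R id (cst 0)); [exact: cvg_id|exact: cvg_cst].
exact: cvg_cst.
Qed.

Lemma continuous_comp_clamp01 (R : realType) (V : topologicalType) (g : R -> V) :
  {within `[0, 1], continuous g} -> continuous (g \o @clamp01 R).
Proof.
move=> /subspace_continuousP cg s.
have /cg : `[0, 1]%classic (clamp01 s) by rewrite /= in_itv /= clamp01_itv.
move=> cgs W /cgs /continuous_clamp01.
apply: (@filterS _ (nbhs s)) => r /=; apply; rewrite in_itv /=.
exact: clamp01_itv.
Qed.

Section RowVectors.
Variables (R : realType) (d : nat).
Implicit Types x y : 'rV[R]_d.

Lemma le_coord_norm x i : `|x 0 i| <= `|x|.
Proof.
rewrite [leRHS]/Num.norm /= mx_normrE.
by apply: le_trans (le_bigmax _ _ (0, i)) => /=.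
Qed.

Lemma norm_row_le x (r : R) : 0 <= r -> (forall i, `|x 0 i| <= r) -> `|x| <= r.
Proof.
move=> r0 xr; rewrite [leLHS]/Num.norm /= mx_normrE; apply/bigmax_leP; split=> //.
by move=> [a i] _ /=; rewrite ord1.
Qed.

Lemma norm_row_lt x (r : R) : 0 < r -> (forall i, `|x 0 i| < r) -> `|x| < r.
Proof.
move=> r0 xr; rewrite [ltLHS]/Num.norm /= mx_normrE; apply/bigmax_ltP; split=> //.
by move=> [a i] _ /=; rewrite ord1.
Qed.

(** The norm of row vectors is the maximum norm, so boxes are its balls. *)
Lemma LambdaE n : @Lambda R d n = [set x | `|x| <= n%:R].
Proof.
apply/seteqP; split=> x /= xn => [|i].
  by apply: norm_row_le => // i; rewrite ler_norml.
by rewrite -ler_norml (le_trans (le_coord_norm _ _)).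
Qed.

Lemma closed_Lambda n : closed (@Lambda R d n).
Proof.
rewrite LambdaE; apply: closed_comp (@closed_le R n%:R) => y _.
exact: norm_continuous.
Qed.

Lemma boundary_Lambda_coord n x : (0 < n)%N -> boundary (Lambda n) x ->
  exists i, `|x 0 i| = n%:R.
Proof.
move=> n0 [clx]; rewrite /interior /= => nint.
have /[!LambdaE]/= xn := closed_Lambda clx.
apply: contrapT => /forallNP ne; apply: nint; rewrite LambdaE.
have xlt : `|x| < n%:R.
  apply: norm_row_lt => [|i]; first by rewrite ltr0n.
  rewrite lt_neqAle (le_trans (le_coord_norm x i) xn) andbT.
  exact/eqP/ne.
near=> y => /=; apply: ltW; near: y.
by apply: (cvgr_lt `|x|) => //; exact: norm_continuous.
Unshelve. all: by end_near. Qed.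

Lemma norm_boundary_Lambda n x : (0 < n)%N -> `|x| = n%:R -> boundary (Lambda n) x.
Proof.
move=> n0 xn; split; first by apply: subset_closure; rewrite LambdaE /= xn.
rewrite /interior /= LambdaE => nx.
(* The points [(1 + t) *: x] with small positive [t] are close to [x] but outside the box. *)
have cZ : (fun t : R => (1 + t) *: x) @ 0 --> x.
  suff : (fun t : R => (1 + t) *: x) @ 0 --> (1 + 0) *: x by rewrite addr0 scale1r.
  apply: cvgZ; last exact: cvg_cst.
  by apply: cvgD; [exact: cvg_cst|exact: cvg_id].
have /nbhs_normP[r /= r0 rx] := cZ _ nx.
have := rx (r / 2); rewrite /= sub0r normrN gtr0_norm ?divr_gt0//.
rewrite ltr_pdivrMr// ltr_pMr// ltr1n => /(_ isT).
rewrite normrZ gtr0_norm ?addr_gt0 ?divr_gt0// xn leNgt.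
by rewrite ltr_pMl ?ltr0n// ltrDl divr_gt0.
Qed.

End RowVectors.

Lemma bounded_part_component (R : realType) d (A : set 'rV[R]_d) y :
  bounded_part A y -> A y /\ bounded_set (connected_component A y).
Proof.
move=> [Ay ny]; split=> //; apply: contrapT => nb; apply: ny.
by exists (connected_component A y); [split=> //;
  exists y|exact: connected_component_refl].
Qed.

(** * Crossings below the level around an isolated cluster *)

Section Surround.
Variables (R : realType) (d : nat).
Variables (u : 'rV[R]_d -> R) (l : R).
Hypothesis cu : continuous u.

Let N := [set y | u y < l].

Lemma excursion_closed : closed (excursion u l).
Proof. by apply: closed_comp (@closed_ge R l) => y _; exact: cu. Qed.

Lemma connected_component_segment (H : R * R -> 'rV[R]_d) a p q :
  continuous H -> (forall t, 0 <= t <= 1 -> N (H (p + t *: (q - p)))) ->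
  connected_component N a (H p) -> connected_component N a (H q).
Proof.
move=> cH Npq aHp; apply: (connected_component_trans aHp).
pose h (t : R) := H (p + t *: (q - p)).
have ch : continuous h.
  move=> t; apply: continuous_comp; last exact: cH.
  apply: cvgD; first exact: cvg_cst.
  by apply: cvgZ; [exact: cvg_id|exact: cvg_cst].
exists (h @` `[0, 1]); last first.
  by exists 1; [rewrite /= in_itv /= ler01 lexx|rewrite /h scale1r addrC subrK].
split.
- by exists 0; [rewrite /= in_itv /= ler01 lexx|rewrite /h scale0r addr0].
- by move=> y [t /= + <-]; rewrite in_itv /=; exact: Npq.
- apply: connected_continuous_connected; first exact: segment_connected.
  exact: continuous_subspaceT.
Qed.

(* The square [-1,1] x [0,1] is cut into cells so small that a cell meeting the
   isolated cluster [K] has its four corners near [K]; hence a cell with mixed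
   corners is mapped into [N] by [H]. *)
Lemma crossing_homotopy (K : set 'rV[R]_d) (e : R) (H : R * R -> 'rV[R]_d) :
  0 < e ->
  (forall a y, K y -> excursion u l a -> `|a - y| < e -> K a) ->
  continuous H ->
  (forall s, -1 <= s <= 1 -> K (H (s, 0))) ->
  (forall s y, -1 <= s <= 1 -> K y -> e <= `|H (s, 1) - y|) ->
  exists t t' : R, [/\ 0 <= t <= 1, 0 <= t' <= 1 &
    connected_component N (H (-1, t)) (H (1, t'))].
Proof.
move=> e0 isoK cH Hbot Htop; have e3 : 0 < e / 3 by rewrite divr_gt0.
pose Q : set (R * R) := `[-1, 1] `*` `[0, 1].
have cQ : compact Q by apply: compact_setX; exact: segment_compact.
have [r r0 Hr] := compact_uniform_modulus cQ cH e3.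
(* Cells have width [2 / m] and height [1 / m] with [m = n.+1], so their diameter is below [r]. *)
have [n nr] : exists n : nat, 2 / n.+1%:R < r.
  have [n _ /(_ n (leqnn n)) /= nr] := near_infty_natSinv_lt (PosNum (divr_gt0 r0
    (ltr0n _ 2))).
  by exists n; rewrite mulrC -ltr_pdivlMr.
pose m := n.+1; have m0 : (0 : R) < m%:R by rewrite ltr0n.
pose p i j : R * R := (-1 + 2 * i%:R / m%:R, j%:R / m%:R).
have fr0 i : (0 : R) <= i%:R / m%:R by rewrite divr_ge0.
have fr1 i : (i <= m)%N -> (i%:R / m%:R : R) <= 1.
  by move=> im; rewrite ler_pdivrMr// mul1r ler_nat.
have sp i : (i <= m)%N -> -1 <= (-1 + 2 * i%:R / m%:R : R) <= 1.
  move=> im; have := fr0 i; have := fr1 i im; rewrite -mulrA.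
  by move: (i%:R / m%:R : R) => z z1 z0; apply/andP; split; lra.
(* [V] marks the grid points sent close to [K], [L] those whose image is joined inside [N] to the
   image of the left side. *)
pose V i j := `[< exists2 k, K k & `|H (p i j) - k| < e / 3 >].
pose L i j := `[< exists2 t, 0 <= t <= 1 & connected_component N (H (-1, t))
  (H (p i j)) >].
pose cell i j := [set z : R * R |
  (p i j).1 <= z.1 <= (p i.+1 j.+1).1 /\ (p i j).2 <= z.2 <= (p i.+1 j.+1).2].
have pS1 i j : (p i.+1 j).1 = (p i j).1 + 2 / m%:R.
  by rewrite /p /= -addrA -mulrDl (mulrSr 1 i) mulrDr mulr1.
have pS2 i j : (p i j.+1).2 = (p i j).2 + 1 / m%:R.
  by rewrite /p /= -mulrDl (mulrSr 1 j).
have cellQ i j z : (i < m)%N -> (j < m)%N -> cell i j z -> Q z.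
  move=> im jm [/andP[z1 z1'] /andP[z2 z2']]; split; rewrite /= in_itv /=.
    have /andP[s0 _] := sp i (ltnW im); have /andP[_ s1] := sp i.+1 im.
    by rewrite (le_trans s0 z1) (le_trans z1' s1).
  by rewrite (le_trans (fr0 j) z2) (le_trans z2' (fr1 j.+1 jm)).
have cell_dist i j z z' : cell i j z -> cell i j z' -> `|z - z'| < r.
  move=> [/andP[z1 z1'] /andP[z2 z2']] [/andP[w1 w1'] /andP[w2 w2']].
  apply: le_lt_trans nr; rewrite prod_normE ge_max.
  move: z1' z2' w1' w2'; rewrite !pS1 !pS2 => z1' z2' w1' w2'.
  have : 1 / m%:R <= 2 / m%:R :> R by rewrite ler_pM2r ?invr_gt0// ler1n.
  move: z1 z1' z2 z2' w1 w1' w2 w2'; move: (1 / _) (2 / _) => A B.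
  move=> z1 z1' z2 z2' w1 w1' w2 w2' AB.
  by apply/andP; split; rewrite /= ler_norml; apply/andP; split; lra.
have cell_conv i j z z' t : cell i j z -> cell i j z' -> 0 <= t <= 1 ->
    cell i j (z + t *: (z' - z)).
  have conv (a b x y : R) : a <= x <= b -> a <= y <= b -> 0 <= t <= 1 ->
      a <= x + t *: (y - x) <= b.
    move=> /andP[ax xb] /andP[ay yb] /andP[t0 t1]; rewrite /GRing.scale /=.
    by apply/andP; split; nra.
  by move=> [z1 z2] [w1 w2] t01; split; apply: conv.
have cell_corner i j : [/\ cell i j (p i j), cell i j (p i.+1 j),
    cell i j (p i j.+1) & cell i j (p i.+1 j.+1)].
  have m2 : (0 : R) <= 2 / m%:R by rewrite divr_ge0.
  have m1 : (0 : R) <= 1 / m%:R by rewrite divr_ge0.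
  by split; split; rewrite ?pS1 ?pS2 ?lexx ?lerDl ?m1 ?m2.
(* If some [H z] of the cell lies in the excursion set, a corner near [K] puts [H z] within
   [2 e / 3] of [K], hence in [K] by isolation, and then all corners are near [K]; so [V] is
   constant on the cell. *)
have mixed i j : (i < m)%N -> (j < m)%N ->
    ~~ [&& V i j == V i.+1 j, V i j == V i j.+1 & V i j == V i.+1 j.+1] ->
    forall z, cell i j z -> N (H z).
  move=> im jm + z cz; rewrite /N /= ltNge; apply: contraNN => lz.
  have Hz z' : cell i j z' -> `|H z - H z'| < e / 3.
    by move=> cz'; apply: Hr; [exact: cellQ cz|exact: cell_dist cz cz'].
  have near_all z' k : cell i j z' -> K k -> `|H z' - k| < e / 3 -> K (H z).
    move=> /Hz zz' Kk kz'; apply: (isoK _ k) => //.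
    rewrite -(subrKA (H z')) (le_lt_trans (ler_normD _ _))//.
    by rewrite (@lt_le_trans _ _ (e / 3 + e / 3)) ?ltrD//; lra.
  have VE i' j' : cell i j (p i' j') -> V i' j' = `[< K (H z) >].
    move=> cp; apply/asbool_equiv_eq; split=> [[k Kk]|Kz].
      exact: near_all cp Kk.
    by exists (H z) => //; rewrite distrC; exact: Hz.
  by have [c1 c2 c3 c4] := cell_corner i j; rewrite !VE// !eqxx.
have Lcell i j z w : cell i j z -> cell i j w -> (forall y, cell i j y -> N (H y)) ->
    (exists2 t, 0 <= t <= 1 & connected_component N (H (-1, t)) (H z)) ->
    (exists2 t, 0 <= t <= 1 & connected_component N (H (-1, t)) (H w)).
  move=> cz cw NH [t t01 tz]; exists t => //.
  by apply: connected_component_segment cH _ tz => a a01; apply/NH/cell_conv.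
have [] := @grid_crossing m m V L.
- move=> i im; apply/asboolP; exists (H (p i 0%N)).
    by rewrite /p mul0r; apply: Hbot; exact: sp.
  by rewrite subrr normr0.
- move=> i im; apply/asboolP => -[k Kk]; apply/negP; rewrite -leNgt.
  rewrite /p divff ?gt_eqF// (le_trans _ (Htop _ k (sp i im) Kk))//.
  by move: e0; lra.
(* A change of [V] on the left side makes the adjacent cell mixed, so this grid point is sent into
   [N] and is joined to itself. *)
- move=> j jm V0; apply/asboolP.
  have [c1 c2 c3 c4] := cell_corner 0%N j.
  have N0 : N (H (p 0%N j)).
    apply: (mixed 0%N j) => //; apply: contraNN V0 => /and3P[_ /eqP -> _].
    exact: eqxx.
  exists (j%:R / m%:R); first by rewrite fr0 (fr1 j (ltnW jm)).
  move: N0; rewrite /p mulr0 mul0r addr0; exact: connected_component_refl.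
- move=> i j im jm /(mixed _ _ im jm) NH.
  have [c1 c2 c3 c4] := cell_corner i j.
  have LE i' j' : cell i j (p i' j') -> L i' j' = L i j.
    by move=> cp; apply/asbool_equiv_eq; split; apply: Lcell NH.
  by rewrite !LE// !eqxx.
move=> j jm /andP[_ /asboolP[t t01 tN]].
exists t, (j%:R / m%:R); split=> //; first by rewrite fr0 (fr1 j (ltnW jm)).
by move: tN; rewrite /p -mulrA divff ?gt_eqF// mulr1 (_ : -1 + 2 = 1)//; lra.
Qed.

End Surround.

Lemma continuous_translate (R : realType) (V : normedModType R) (c : V) :
  continuous (fun y : V => y + c).
Proof. by move=> y; apply: cvgD; [exact: cvg_id|exact: cvg_cst]. Qed.

(* Above s <= 0 the half-lines issued from g 0 rotate from -E to E;
   above s >= 0 the half-line of direction E is transported along g. *)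
Definition sweep (R : realType) d (g : R -> 'rV[R]_d) (E E' : 'rV[R]_d) (M : R)
    (p : R * R) : 'rV[R]_d :=
  let a := Num.min p.1 0 in
  g (Num.max p.1 0) + (M * p.2) *: ((1 + 2 * a) *: E + (1 - `|1 + 2 * a|) *: E').

Lemma continuous_sweep (R : realType) d (g : R -> 'rV[R]_d) E E' M :
  continuous g -> continuous (sweep g E E' M).
Proof.
move=> cg p.
have c1 : continuous (fun p : R * R => p.1) by move=> z; exact: cvg_fst.
have c2 : continuous (fun p : R * R => p.2) by move=> z; exact: cvg_snd.
have c0 (c : R) : continuous (fun _ : R * R => c) by move=> z; exact: cvg_cst.
have cm : {for p, continuous (fun p : R * R => 1 + 2 * Num.min p.1 0)}.
  apply: cvgD; first exact: c0.
  apply: cvgM; first exact: c0.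
  by apply: (@continuous_min R _ (fun p : R * R => p.1) (cst 0));
    [exact: c1|exact: c0].
apply: cvgD.
  apply: (@continuous_comp _ _ _ (fun p : R * R => Num.max p.1 0) g); last exact: cg.
  by apply: (@continuous_max R _ (fun p : R * R => p.1) (cst 0));
    [exact: c1|exact: c0].
apply: cvgZ; first by apply: cvgM; [exact: c0|exact: c2].
apply: cvgD; apply: cvgZ; try exact: cvg_cst; first exact: cm.
apply: cvgB; first exact: c0.
by apply: cvg_norm; exact: cm.
Qed.

(** [crossing_homotopy] applied to [sweep] joins [gam 0 - T *: E] to [gam 1 + T' *: E] below the
    level, with nonnegative [T] and [T']. A translation by [m%:R *: E] brings the first point back
    to [Lambda 1] and the second to distance at least [n + m]. Integer shifts along the axes form a
    countable family, as the union bound requires. *)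
Lemma bounded_cluster_surrounded (R : realType) d (u : 'rV[R]_d -> R) (l : R) n :
  (2 <= d)%N -> (0 < n)%N -> continuous u ->
  joined (Lambda 1) (bounded_part (excursion u l)) (boundary (Lambda n)) ->
  exists (i : 'I_d) (s : bool) (m : nat) (a b : 'rV[R]_d),
    [/\ connected_component
          [set y | u (y + ((-1) ^+ s * m%:R) *: delta_mx 0 i) < l] a b,
        Lambda 1 a & (n + m)%:R <= `|b|].
Proof.
move=> d2 n0 cu [gam [cgam gamB gam0 gam1]].
have [i gi] := boundary_Lambda_coord n0 gam1.
(* The rotation from [-E] to [E] passes through a second direction, so as to avoid the zero vector;
   this is where [2 <= d] enters. *)
have [j ji] : exists j : 'I_d, j != i.
  apply/existsP; rewrite -[X in is_true X]negbK negb_exists;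
    apply/negP => /forallP all.
  suff : (#|'I_d| <= 1)%N by rewrite card_ord leqNgt d2.
  apply/card_le1_eqP => x y _ _.
  by have := all x; have := all y; rewrite !negbK => /eqP -> /eqP ->.
pose s := 0 <= gam 1 0 i.
pose sg : R := (-1) ^+ s; have sg2 : sg * sg = 1 by rewrite -expr2 sqrr_sign.
have gsg : - sg * gam 1 0 i = n%:R.
  rewrite -gi /sg /s; case: ger0P => g0; first by rewrite expr1 opprK mul1r.
  by rewrite expr0 mulN1r.
pose A := excursion u l.
have A01 t : 0 <= t <= 1 -> A (gam t) by move=> /gamB[].
have t00 : (0 : R) <= (0 : R) <= 1 by rewrite lexx ler01.
have t11 : (0 : R) <= (1 : R) <= 1 by rewrite lexx ler01.
have [Ag0 bg0] := bounded_part_component (gamB _ t00).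
have [K [e [e0 bK CK isoK]]] := bounded_component_isolated
  (@bounded_closed_compact R d) (excursion_closed (l := l) cu) Ag0 bg0.
pose g := gam \o @clamp01 R.
have cg : continuous g by exact: continuous_comp_clamp01.
have gE t : 0 <= t <= 1 -> g t = gam t by move=> t01; rewrite /g /= clamp01_id.
have gK t : K (g t).
  apply: CK; rewrite -(gE _ t00).
  exists (range g); last by exists t.
  split; first by exists 0.
    by move=> _ [r _ <-]; apply: A01; exact: clamp01_itv.
  apply: connected_continuous_connected; last exact: continuous_subspaceT.
  by apply/connected_intervalP => ? ? ? ? ?.
have [rho0 [_ bKr]] := bK; pose rho := rho0 + 1.
have Krho y : K y -> `|y| <= rho by apply: bKr; rewrite ltrDl.
pose E : 'rV[R]_d := (- sg) *: delta_mx 0 i.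
pose E' : 'rV[R]_d := delta_mx 0 j.
(* The rotating directions have norm at least 1/2, so the displacement on the top side has norm at
   least [rho + rho + e]. As [K] has radius [rho], that side stays at distance at least [e] from
   [K]. *)
pose M := 2 * (rho + rho + e).
have rho_ge0 : 0 <= rho by rewrite (le_trans _ (Krho _ (gK 0))).
have re_ge0 : 0 <= rho + rho + e by move: rho_ge0 e0; lra.
have M0 : 0 <= M by rewrite mulr_ge0.
have vE (a : R) : 2^-1 <= `|(1 + 2 * a) *: E + (1 - `|1 + 2 * a|) *: E'|.
  set v := _ + _.
  have vi : `|v 0 i| = `|1 + 2 * a|.
    rewrite !mxE !eqxx /= eq_sym (negbTE ji) mulr0 addr0 mulr1 normrM normrN.
    by rewrite normr_sign mulr1.
  have vj : v 0 j = 1 - `|1 + 2 * a|.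
    by rewrite !mxE !eqxx /= (negbTE ji) !mulr0 add0r mulr1.
  have := le_coord_norm v i; have := le_trans (ler_norm _) (le_coord_norm v j).
  rewrite vi vj; move: `|1 + 2 * a| `|v| => A1 A2; lra.
have [||t [t' [t01 t01' conn]]] := crossing_homotopy e0 isoK
    (continuous_sweep (E := E) (E' := E') (M := M) cg).
- by move=> r _; rewrite /sweep /= mulr0 scale0r addr0.
- move=> r y _ Ky; rewrite /sweep /= mulr1; set v := (_ *: E + _ *: E').
  have vM : rho + rho + e <= `|M *: v|.
    rewrite normrZ ger0_norm// /M mulrAC ler_peMl//.
    by rewrite -ler_pdivrMl// mulr1; exact: vE.
  have gr := Krho _ (gK (Num.max r 0)); have yr := Krho _ Ky.
  set w := g _ in gr *.
  have := ler_normB (w + M *: v - y) (w - y); rewrite opprB.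
  rewrite addrA subrK (addrC w (M *: v)) addrK.
  have := ler_normB w y; move: vM gr yr.
  move: `|M *: v| `|w - y| `|w| `|y| => B1 B3 B4 B5.
  by move: `|M *: v + w - y| => B2; lra.
(* At the ends -1 and 1 the half-lines have directions [-E] and [E], and the component along [E']
   vanishes. *)
move: conn; rewrite /sweep /=.
rewrite (max_idPr _) ?lerN10// (min_idPl _) ?lerN10// (max_idPl _)// (min_idPr _)//.
rewrite mulr0 addr0 normr1 subrr scale0r addr0 scale1r.
have -> : (1 + 2 * -1 : R) = -1 by lra.
rewrite normrN1 subrr scale0r addr0 scaleN1r scalerN (gE _ t00) (gE _ t11).
case/andP: t01 => t0 _; case/andP: t01' => t0' _.
set T := M * t; set T' := M * t'.
have T0 : 0 <= T by rewrite mulr_ge0.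
have T0' : 0 <= T' by rewrite mulr_ge0.
move=> conn.
pose x := - sg * gam 0 0 i.
have x1 : -1 <= x <= 1.
  rewrite -ler_norml /x normrM normrN normr_sign mul1r.
  by rewrite (le_trans (le_coord_norm _ _))//; move: gam0; rewrite LambdaE.
(* The integer part of [T - x] moves the coordinate [x - T] into [-1, 1]; when [T < x] it is already
   there, since [T >= 0] and [x <= 1]. *)
pose m := if 0 <= T - x then Num.truncn (T - x) else 0%N.
have mT : -1 <= x - T + m%:R <= 1.
  rewrite /m; have [Tx|Tx] := leP 0 (T - x); last by apply/andP; split; lra.
  have /andP[] := truncn_itv Tx; rewrite -natr1.
  by move: (_%:R : R) => k *; apply/andP; split; lra.
pose h (y : 'rV[R]_d) : 'rV[R]_d := y + m%:R *: E.
exists i, s, m, (h (gam 0 - T *: E)), (h (gam 1 + T' *: E)); split.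
- apply: (@connected_component_image _ _ _ _ h _ _ _ _ conn).
    exact: continuous_translate.
  move=> y /=; rewrite /h /E scalerA mulrN scaleNr -/sg [sg * _]mulrC.
  by rewrite subrK.
- move=> k; rewrite /h !mxE; have [->|ki] := eqVneq k i.
    rewrite -(@ler_norml _ (_ + _) 1).
    have -> : gam 0 0 i - T * (- sg * (true && true)%:R) +
      m%:R * (- sg * (true && true)%:R)
       = - sg * (x - T + m%:R).
      rewrite /x /= mulr1 !mulrDr mulrA mulrNN sg2 mul1r; ring.
    by rewrite normrM normrN normr_sign mul1r ler_norml.
  rewrite andbF !mulr0 subr0 addr0.
  by move: gam0 => /(_ k).
- apply: le_trans (le_coord_norm _ i).
  have -> : h (gam 1 + T' *: E) 0 i = - sg * (n%:R + T' + m%:R).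
    rewrite /h !mxE !eqxx /= mulr1 -gsg !mulrDr mulrA mulrNN sg2 mul1r; ring.
  rewrite normrM normrN normr_sign mul1r ger0_norm; last by rewrite !addr_ge0.
  by rewrite natrD lerD2r lerDl.
Qed.

(** * Measurable connection events *)

Section RationalVectors.
Variables (R : realType) (d : nat).

Definition rat_vec (q : 'rV[rat]_d) : 'rV[R]_d := map_mx ratr q.

Lemma rat_vec_dense (y : 'rV[R]_d) (e : R) : 0 < e ->
  exists q, `|y - rat_vec q| < e.
Proof.
move=> e0.
have qi i : {q : rat | ratr q \in `]y 0 i - e, y 0 i + e[}.
  by apply/cid/rat_in_itvoo; rewrite ltrD2l gtrN.
exists (\row_i projT1 (qi i)); apply: norm_row_lt => // i; rewrite !mxE.
have := projT2 (qi i); rewrite in_itv /= => /andP[q1 q2].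
by rewrite ltr_norml; apply/andP; split; lra.
Qed.

End RationalVectors.

Section JoinedPaths.
Variables (R : realType) (d : nat).
Implicit Types (A B C : set 'rV[R]_d) (x y z : 'rV[R]_d).

Lemma joined_segment B x y :
  (forall t, 0 <= t <= 1 -> B (x + t *: (y - x))) -> joined [set x] B [set y].
Proof.
move=> Bxy; exists (fun t => x + t *: (y - x)); split => //.
- apply: continuous_subspaceT => t; apply: cvgD; first exact: cvg_cst.
  by apply: cvgZ; [exact: cvg_id|exact: cvg_cst].
- by rewrite scale0r addr0.
- by rewrite scale1r addrC subrK.
Qed.

(* Both halves are extended by constants, so that the concatenation is the
   continuous function [g1 (2 t) + g2 (2 t - 1) - y]. *)
Lemma joined_trans A B C y : joined A B [set y] -> joined [set y] B C ->
  joined A B C.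
Proof.
move=> [g1 [cg1 B1 A1 y1]] [g2 [cg2 B2 y2 C2]].
pose h1 := g1 \o @clamp01 R; pose h2 := g2 \o @clamp01 R.
have ch1 : continuous h1 by exact: continuous_comp_clamp01.
have ch2 : continuous h2 by exact: continuous_comp_clamp01.
have caff (c : R) : continuous (fun t : R => 2 * t - c).
  move=> t; apply: cvgB; last exact: cvg_cst.
  by apply: cvgM; [exact: cvg_cst|exact: cvg_id].
have h1E t : 1 <= t -> h1 t = y.
  by move=> t1; rewrite /h1 /= /clamp01 min_r ?le_max ?t1.
have h2E t : t <= 0 -> h2 t = y.
  by move=> t0; rewrite /h2 /= /clamp01 max_r// min_l.
have h10 : h1 0 = g1 0 by rewrite /h1 /= clamp01_id// lexx ler01.
have h21 : h2 1 = g2 1 by rewrite /h2 /= clamp01_id// lexx ler01.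
exists (fun t => h1 (2 * t - 0) + h2 (2 * t - 1) - y); split.
- apply: continuous_subspaceT => t; apply: cvgB; last exact: cvg_cst.
  apply: cvgD.
    exact: (continuous_comp (caff 0 t) (ch1 _)).
  exact: (continuous_comp (caff 1 t) (ch2 _)).
- move=> t _; have [t2|t2] := leP (2 * t) 1.
    by rewrite h2E ?subr_le0// addrK; apply: B1; exact: clamp01_itv.
  by rewrite h1E ?subr0 ?ltW// addrAC subrr add0r; apply: B2; exact: clamp01_itv.
- by rewrite mulr0 subr0 h10 h2E ?addrK// sub0r oppr_le0.
- rewrite mulr1 subr0 h1E ?ler1n// (_ : 2 - 1 = 1) ?h21; last by lra.
  by rewrite addrAC subrr add0r.
Qed.

(** The curve is stopped at a time when its norm equals [n], given by the intermediate value
    theorem, and reparametrised. *)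
Lemma joined_boundary_Lambda B n : (0 < n)%N ->
  joined (Lambda 1) B [set y | n%:R <= `|y|] ->
  joined (Lambda 1) B (boundary (Lambda n)).
Proof.
move=> n0 [g [cg gB g0 g1]]; pose h := g \o @clamp01 R.
have ch : continuous h by exact: continuous_comp_clamp01.
have h0 : h 0 = g 0 by rewrite /h /= clamp01_id// lexx ler01.
have h1 : h 1 = g 1 by rewrite /h /= clamp01_id// lexx ler01.
have h0n : `|h 0| <= n%:R.
  rewrite h0; move: g0; rewrite LambdaE /= => /le_trans; apply.
  by rewrite ler_nat.
have h1n : n%:R <= `|h 1| by rewrite h1.
have [||c c01 hc] := @IVT R (fun t => `|h t|) 0 1 n%:R ler01.
- apply: continuous_subspaceT => t.
  by apply: continuous_comp; [exact: ch|exact: norm_continuous].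
- by rewrite ge_min h0n le_max h1n orbT.
exists (fun t => h (c * t)); split.
- apply: continuous_subspaceT => t; apply: (@continuous_comp _ _ _ ( *%R c) h).
    by apply: cvgM; [exact: cvg_cst|exact: cvg_id].
  exact: ch.
- by move=> t _; apply: gB; exact: clamp01_itv.
- by rewrite mulr0 h0.
- by rewrite mulr1; exact: norm_boundary_Lambda.
Qed.

End JoinedPaths.

Section ChainEvent.
Variables (R : realType) (d : nat).
Implicit Types (b : 'rV[rat]_d * rat) (x y : 'rV[R]_d).

Definition rat_ball b : set 'rV[R]_d := [set x | `|x - rat_vec R b.1| < ratr b.2].

Definition overlap : rel ('rV[rat]_d * rat) :=
  fun b b' => `[< exists x, rat_ball b x /\ rat_ball b' x >].

(* A countable substitute for the connection of [Lambda 1] to the outside of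
   [Lambda n] in [{u <= l}]: a chain of overlapping rational balls. *)
Definition chain_event (l : R) (n : nat) : set ('rV[rat]_d -> R) :=
  [set v | exists b s,
    [/\ path overlap b s,
        (exists2 x, Lambda 1 x & rat_ball b x),
        (exists2 y, n%:R <= `|y| & rat_ball (last b s) y) &
        forall c, c \in b :: s -> forall q, rat_ball c (rat_vec R q) -> v q <= l]].

Lemma rat_ball_convex b x y (t : R) : rat_ball b x -> rat_ball b y ->
  0 <= t <= 1 -> rat_ball b (x + t *: (y - x)).
Proof.
rewrite /rat_ball /=; set c := rat_vec R _ => xb yb /andP[t0 t1].
have -> : x + t *: (y - x) - c = (1 - t) *: (x - c) + t *: (y - c).
  by apply/rowP => i; rewrite !mxE; ring.
rewrite (le_lt_trans (ler_normD _ _))// !normrZ !ger0_norm ?subr_ge0//.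
move: `|x - c| `|y - c| xb yb => X Y xb yb; have [->|tn] := eqVneq t 0.
  by rewrite subr0 mul1r mul0r addr0.
have tp : 0 < t by rewrite lt_neqAle eq_sym tn.
nra.
Qed.

Lemma open_rat_ball b : open (rat_ball b).
Proof.
rewrite (_ : rat_ball b = ball (rat_vec R b.1) (ratr b.2)); first exact: ball_open.
by rewrite -ball_normE; apply/seteqP; split=> x; rewrite /rat_ball /= distrC.
Qed.

Lemma rat_ball_nbhs (A : set 'rV[R]_d) x : open A -> A x ->
  exists b, rat_ball b x /\ rat_ball b `<=` A.
Proof.
move=> oA Ax; have /nbhs_normP[e /= e0 eA] : nbhs x A by exact: open_nbhs_nbhs.
have e2 : 0 < e / 2 by rewrite divr_gt0.
have [r] := rat_in_itvoo e2; rewrite in_itv /= => /andP[r0 re].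
have [q xq] := rat_vec_dense x r0.
exists (q, r); split=> // y /= yq; apply: eA => /=.
rewrite -(subrKA (rat_vec R q)) (le_lt_trans (ler_normD _ _))//.
rewrite (distrC _ y) [e]splitr.
by rewrite ltrD// (lt_trans _ re).
Qed.

(** The points reached by chains of rational balls inside the open set [N] form an open set,
    relatively closed in [N], so they exhaust the component of [x]. *)
Lemma connected_chain_event (u : 'rV[R]_d -> R) l n x y : continuous u ->
  connected_component [set z | u z < l] x y -> Lambda 1 x -> n%:R <= `|y| ->
  chain_event l n (u \o @rat_vec R d).
Proof.
move=> cu xy x1 yn; set N := [set z | u z < l] in xy.
have oN : open N by apply: open_comp (@open_lt R l) => z _; exact: cu.
pose S := [set z | exists b s, [/\ path overlap b s, rat_ball b x,
  rat_ball (last b s) z & forall c, c \in b :: s -> rat_ball c `<=` N]].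
suff [b [s [bs bx by_ sN]]] : S y.
  exists b, s; split=> //; first by exists x.
    by exists y.
  by move=> c cs q /(sN c cs) /ltW.
have Nx : N x.
  by apply: contrapT => /connected_component_out x0; move: xy; rewrite /N x0.
set C := connected_component N x.
suff : C `&` S = C by move=> /seteqP[_ +]; move=> /(_ y xy)[].
apply: (@component_connected _ N x).
- exists x; split; first exact: connected_component_refl.
  have [b [bx bN]] := rat_ball_nbhs oN Nx.
  by exists b, [::]; split=> // c; rewrite inE => /eqP ->.
- exists S => //; rewrite openE => z [b [s [bs bx bz sN]]].
  have : nbhs z (rat_ball (last b s)).
    by apply: open_nbhs_nbhs; split=> //; exact: open_rat_ball.
  by apply: filterS => w bw; exists b, s.
- exists (closure S); first exact: closed_closure.
  apply/seteqP; split=> z [Cz Sz]; split=> //; first exact: subset_closure.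
  have Nz : N z by exact: (connected_component_sub Cz).
  have [b' [bz' bN']] := rat_ball_nbhs oN Nz.
  have [w [[b [s [bs bx bw sN]]] bw']] : S `&` rat_ball b' !=set0.
    by apply: Sz; apply: open_nbhs_nbhs; split=> //; exact: open_rat_ball.
  exists b, (rcons s b'); split; rewrite ?last_rcons//.
    by rewrite rcons_path bs /=; apply/asboolP; exists w.
  by move=> c; rewrite -rcons_cons mem_rcons inE => /predU1P[->|/sN].
Qed.

(** Density of the rational points and continuity extend the weak inequality to whole balls;
    segments through the successive overlaps then form the curve. *)
Lemma chain_event_joined (u : 'rV[R]_d -> R) l n : (0 < n)%N -> continuous u ->
  chain_event l n (u \o @rat_vec R d) ->
  joined (Lambda 1) [set z | u z <= l] (boundary (Lambda n)).
Proof.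
move=> n0 cu [b [s [bs [x x1 bx] [y yn sy] sl]]].
set B := [set z | u z <= l].
have clB : closed B by apply: closed_comp (@closed_le R l) => z _; exact: cu.
have {}sl c : c \in b :: s -> rat_ball c `<=` B.
  move=> cs z cz; apply: clB => W Wz.
  have : nbhs z (W `&` rat_ball c).
    by apply: filterI => //; apply: open_nbhs_nbhs; split=> //; exact: open_rat_ball.
  move=> /nbhs_normP[e /= e0 eW]; have [q zq] := rat_vec_dense z e0.
  have [Wq cq] := eW _ zq; exists (rat_vec R q); split=> //.
  exact: sl cs q cq.
have convex c z w : rat_ball c `<=` B -> rat_ball c z -> rat_ball c w ->
    joined [set z] B [set w].
  move=> cB cz cw; apply: joined_segment => t t01; apply: cB.
  exact: rat_ball_convex.
have [g [cg gB g0 g1]] : joined [set x] B [set y].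
  move: {x1} x bx; elim: s b bs sy sl => [|c s IHs] b /=.
    by move=> _ yb sl x bx; apply: convex bx yb; apply: sl; exact: mem_head.
  move=> /andP[/asboolP[w [bw cw]] cs] sy sl x bx.
  apply: (@joined_trans _ _ _ _ _ w).
    by apply: convex bx bw; apply: sl; exact: mem_head.
  by apply: IHs cw => // c' c's; apply: sl; rewrite inE c's orbT.
by apply: joined_boundary_Lambda => //; exists g; split=> //; rewrite ?g0 ?g1.
Qed.

End ChainEvent.

(** * Laws of Gaussian fields *)

Section GaussianLaw.
Variable R : realType.
Local Notation mR := (measurableTypeR R).

Lemma eq_measure_rays (m1 m2 : {measure set mR -> \bar R}) :
  (forall x, m1 `[x, +oo[%classic < +oo)%E ->
  (forall x, m1 `[x, +oo[%classic = m2 `[x, +oo[%classic) ->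
  forall A : set mR, measurable A -> m1 A = m2 A.
Proof.
move=> m1oo m12 A; rewrite RGenCInfty.measurableE.
have Gm : @RGenCInfty.G R `<=` (@measurable _ mR).
  by move=> B [x ->]; exact: measurable_itv.
move=> mA; refine (@g_sigma_algebra_measure_unique _ R mR _ Gm
  (fun k => `[- k%:R, +oo[%classic) _ _ m1 m2 _ _ _ A mA).
- by move=> k; exists (- k%:R).
- rewrite -subTset => x _; exists (Num.truncn `|x|).+1 => //=.
  rewrite in_itv /= andbT lerNl; apply: le_trans (ler_norm _) _.
  by rewrite normrN ltW// truncnS_gt.
- move=> B C [x ->] [y ->]; exists (Num.max x y).
  apply/seteqP; split=> z /=; rewrite !in_itv /= !andbT ge_max; last by move/andP.
  by move=> [-> ->].
- by move=> B [x ->].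
- by move=> k; exact: m1oo.
Qed.

Lemma normal_pdf_scale (s x : R) : 0 < s ->
  normal_pdf 0 1 (x / s) * s^-1 = normal_pdf 0 s x.
Proof.
move=> s0; rewrite /normal_pdf oner_eq0 gt_eqF//.
rewrite /normal_peak /normal_fun !subr0 expr1n mul1r mulrAC; congr (_ * _).
  rewrite -mulrnAr (sqrtrM (pi *+ 2)) ?sqr_ge0// sqrtr_sqr gtr0_norm//.
  by rewrite invfM mulrC.
congr expR; rewrite expr_div_n !mulNr; congr (- _).
by rewrite -(mulr_natr (s ^+ 2)); field; exact: lt0r_neq0.
Qed.

Lemma normal_prob_scale_ray (s x : R) : 0 < s ->
  normal_prob 0 s `[x, +oo[%classic = normal_prob 0 1 `[x / s, +oo[%classic.
Proof.
move=> s0; rewrite /normal_prob.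
have F'E : (fun y : R => y / s)^`()%classic = cst s^-1.
  apply/funext => y; rewrite derive1E deriveM// derive_id derive_cst scaler0 add0r.
  by rewrite /GRing.scale /= mulr1.
rewrite (@increasing_ge0_integration_by_substitutiony _ (fun y => y / s)).
- by apply: eq_integral => y _; rewrite F'E !fctE /= normal_pdf_scale.
- by move=> a b _ _; rewrite ltr_pM2r ?invr_gt0.
- by move=> y _; rewrite F'E; exact: cvg_cst.
- by rewrite F'E; exact: is_cvg_cst.
- by rewrite F'E; exact: is_cvg_cst.
- split=> [y _|]; first exact: derivableM.
  by apply: cvgM; [exact: cvg_at_right_filter|exact: cvg_cst].
- by apply: gt0_cvgMly; [rewrite invr_gt0|exact: cvg_id].
- by apply: continuous_subspaceT; apply: continuous_normal_pdf; exact: oner_neq0.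
- by move=> y _; exact: normal_pdf_ge0.
Qed.

Lemma normal_prob_norm (s : R) (A : set mR) :
  normal_prob 0 `|s| A = normal_prob 0 s A.
Proof.
apply: eq_integral => x _; congr EFin; rewrite /normal_pdf normr_eq0.
by case: eqVneq => // _; rewrite /normal_peak /normal_fun real_normK ?num_real.
Qed.

(** Hides the image measure behind its values and its change of variables formula, the only facts
    used about it. *)
Lemma law_measure d d' (T : measurableType d) (T' : measurableType d')
    (mu : {measure set T -> \bar R}) (X : T -> T') : measurable_fun setT X ->
  exists m : {measure set T' -> \bar R}, (forall A, m A = mu (X @^-1` A)) /\
    (forall f : T' -> \bar R, measurable_fun setT f -> (forall y, 0 <= f y)%E ->
      (\int[m]_y f y = \int[mu]_x f (X x))%E).
Proof.
move=> mX; unshelve eexists (pushforward mu X : {measure set _ -> \bar R}).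
  exact: mX.
by split=> // f mf f0; rewrite ge0_integral_pushforward.
Qed.

(** Writing the law as that of [s] times a standard normal variable treats the degenerate case
    [s = 0] together with the others. *)
Lemma centred_gaussianP d (T : measurableType d) (P : probability T R)
    (X : T -> R) : centred_gaussian P X ->
  exists2 s : R, 0 <= s & forall A : set mR, measurable A ->
    P (X @^-1` A) = normal_prob 0 1 ( *%R s @^-1` A).
Proof.
move=> [mX [s lawX]]; exists `|s| => // A mA; rewrite lawX//.
have [->|s0] := eqVneq s 0.
  rewrite normr0 diracE; have [A0|A0] := boolP (0 \in A).
    rewrite (_ : _ @^-1` A = setT) ?probability_setT//.
    by apply/seteqP; split=> z //= _; rewrite mul0r; exact: set_mem.
  rewrite (_ : _ @^-1` A = set0) ?measure0//.
  by apply/seteqP; split=> z //=; rewrite mul0r => /mem_set; rewrite (negbTE A0).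
have ms : measurable_fun setT ( *%R `|s| : mR -> mR) by exact: mulrl_measurable.
have [m [mE _]] := law_measure (normal_prob 0 1) ms.
rewrite -mE -normal_prob_norm; apply: eq_measure_rays => // [x|x].
  by rewrite -ge0_fin_numE// fin_num_measure.
have s_gt0 : 0 < `|s| by rewrite normr_gt0.
refine (etrans (normal_prob_scale_ray x s_gt0) _).
rewrite mE; congr (normal_prob _ _ _).
by apply/seteqP; split=> z /=; rewrite !in_itv /= !andbT ler_pdivrMr// mulrC.
Qed.

Lemma centred_gaussian_second_moment d (T : measurableType d)
    (P : probability T R) (X : T -> R) (s : R) : measurable_fun setT X ->
  (forall A : set mR, measurable A ->
     P (X @^-1` A) = normal_prob 0 1 ( *%R s @^-1` A)) ->
  (\int[P]_w (X w ^+ 2)%:E =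
   (s ^+ 2)%:E * \int[normal_prob 0 1]_(x in [set: mR]) (x ^+ 2)%:E)%E.
Proof.
move=> mX lawX; have [m [mE mI]] := @law_measure _ _ T mR P X mX.
have ms : measurable_fun setT ( *%R s : mR -> mR) by exact: mulrl_measurable.
have [m' [mE' mI']] := law_measure (normal_prob 0 1) ms.
have msq : measurable_fun [set: mR] (fun x : mR => (x ^+ 2 : R)%:E).
  by apply/measurable_EFinP; exact: exprn_measurable.
rewrite -(mI (fun x => (x ^+ 2)%:E))//; last by move=> x; rewrite lee_fin sqr_ge0.
transitivity (\int[m']_x (x ^+ 2 : R)%:E)%E.
  by apply: eq_measure_integral => A mA _; rewrite mE mE'; exact: lawX.
rewrite (mI' (fun x => (x ^+ 2)%:E))//; last by move=> x; rewrite lee_fin sqr_ge0.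
rewrite -ge0_integralZl//=; last 2 first.
  by move=> x _; rewrite lee_fin sqr_ge0.
  by rewrite lee_fin sqr_ge0.
by apply: eq_integral => x _ /=; rewrite -EFinM exprMn.
Qed.

(** Otherwise the normal law would be carried by the point 0, which is null for it by absolute
    continuity. *)
Lemma normal_second_moment_gt0 :
  (0 < \int[normal_prob (0 : R) 1]_(x in [set: mR]) (x ^+ 2 : R)%:E)%E.
Proof.
have msq : measurable_fun [set: mR] (fun x : mR => ((x ^+ 2 : R)%:E)).
  by apply/measurable_EFinP; exact: exprn_measurable.
rewrite lt_neqAle integral_ge0 ?andbT; last by move=> x _; rewrite lee_fin sqr_ge0.
apply/eqP => /esym I0.
have : (\int[normal_prob 0 1]_(x in [set: mR]) `|(x ^+ 2 : R)%:E| = 0)%E.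
  by rewrite -[RHS]I0; apply: eq_integral => x _; rewrite gee0_abs// lee_fin sqr_ge0.
move=> /(ae_eq_integral_abs _ measurableT msq)[N [mN N0 sN]].
have n0 : normal_prob (0 : R) 1 [set (0 : R)] = 0%E.
  have := @normal_prob_dominates R 0 1; move/null_content_dominatesP; apply.
    exact: measurable_set1.
  exact: lebesgue_measure_set1.
have : (normal_prob (0 : R) 1 setT <= normal_prob (0 : R) 1 N +
  normal_prob (0 : R) 1 [set (0 : R)%R])%E.
  rewrite (le_trans _ (measureU2 _ _ _))//.
    apply: le_measure; rewrite ?inE//.
      by apply: measurableU.
    move=> x _; have [->|x0] := eqVneq x 0; [by right|left].
    apply: sN => /= /(_ I) [] /eqP; rewrite sqrf_eq0; exact/negP.
by rewrite N0 n0 adde0 probability_setT leNgt lte_fin ltr01.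
Qed.

(** Both second moments are squares of scales times that of the standard normal law, whose
    positivity is enough. Its finiteness is not computed either: were it infinite, finiteness for
    [X] would force [s = 0], and then [t = 0]. *)
Lemma eq_second_moment_law d (T : measurableType d) (P : probability T R)
    (X Y : T -> R) : centred_gaussian P X -> centred_gaussian P Y ->
  (\int[P]_w (X w ^+ 2)%:E < +oo)%E ->
  (\int[P]_w (X w ^+ 2)%:E = \int[P]_w (Y w ^+ 2)%:E)%E ->
  forall A : set mR, measurable A -> P (X @^-1` A) = P (Y @^-1` A).
Proof.
move=> gX gY Xoo XY A mA.
have [s s0 lX] := centred_gaussianP gX; have [t t0 lY] := centred_gaussianP gY.
rewrite lX// lY//; suff -> : s = t by [].
move: XY Xoo; rewrite (centred_gaussian_second_moment _ lX); last by case: gX.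
rewrite (centred_gaussian_second_moment _ lY); last by case: gY.
have := normal_second_moment_gt0; case: (integral _ _ _) => [m| |]//=.
  rewrite lte_fin => m0; rewrite -!EFinM => -[] /(mulIf (lt0r_neq0 m0)) /eqP st _.
  by apply/eqP; rewrite -(eqrXn2 (n := 2)).
move=> _; have [->|sn] := eqVneq s 0.
  have [->//|tn] := eqVneq t 0.
  by rewrite expr0n mul0e gt0_muley ?lte_fin ?exprn_gt0// lt_neqAle eq_sym tn.
by move=> _; rewrite gt0_muley ?lte_fin ?exprn_gt0// lt_neqAle eq_sym sn.
Qed.

End GaussianLaw.

(** * Step functions as limits of polynomials in a sine *)

Section StepApproximation.
Variable R : realType.
Implicit Types (r v x : R) (n : nat).

(** With [s] the square root of [r], Bernoulli's inequality bounds [n%:R * s ^+ n], and the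
    remaining factor [s ^+ n] tends to 0. *)
Lemma cvg_natM_expr r : 0 <= r < 1 -> n%:R * r ^+ n @[n --> \oo] --> (0 : R).
Proof.
move=> /andP[r0 r1]; have [->|rn0] := eqVneq r 0.
  apply: cvg_near_cst; near=> n; rewrite expr0n gtn_eqF ?mulr0//.
  by near: n; exists 1%N.
have rp : 0 < r by rewrite lt_neqAle eq_sym rn0.
pose s := Num.sqrt r; have sp : 0 < s by rewrite sqrtr_gt0.
have s1 : s < 1 by rewrite -[ltRHS]sqrtr1 ltr_sqrt.
have h0 : 0 < s^-1 - 1 by rewrite subr_gt0 invf_gt1.
have bern n : n%:R * (s^-1 - 1) <= s^-1 ^+ n.
  have -> : s^-1 = 1 + (s^-1 - 1) by rewrite addrC subrK.
  rewrite [1 + _ - 1]addrAC subrr add0r; move: (s^-1 - 1) h0 => h h0.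
  elim: n => [|n IHn]; first by rewrite mul0r expr0.
  rewrite exprSr mulrDr mulr1 -natr1 mulrDl mul1r lerD// ler_peMl ?(ltW h0)//.
  by rewrite exprn_ege1// lerDl ltW.
apply: (@squeeze_cvgr _ _ _ _ (cst 0) (fun n => (s^-1 - 1)^-1 * s ^+ n)).
- near=> n; rewrite mulr_ge0 ?exprn_ge0//= ler_pdivlMl//.
  have -> : r = s * s by rewrite -expr2 sqr_sqrtr.
  rewrite exprMn mulrA mulrA ler_piMl ?exprn_ge0 ?(ltW sp)// [_ * n%:R]mulrC.
  by rewrite -ler_pdivlMr ?exprn_gt0// mul1r -exprVn.
- exact: cvg_cst.
- rewrite -[X in _ --> X](mulr0 (s^-1 - 1)^-1); apply: cvgM; first exact: cvg_cst.
  by apply: cvg_expr; rewrite gtr0_norm.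
Unshelve. all: by end_near. Qed.

(* The exponents are chosen so that, as n tends to infinity, bump n v tends
   to 1 for v < 1/2 and to 0 for 1/2 <= v <= 1. *)
Definition bump n v : R := (1 - v ^+ n) ^+ (n * 2 ^ n).

Lemma bump_itv n v : 0 <= v <= 1 -> 0 <= bump n v <= 1.
Proof.
move=> /andP[v0 v1]; have vn1 : v ^+ n <= 1 by rewrite exprn_ile1.
by rewrite exprn_ge0 ?exprn_ile1 ?subr_ge0// lerBlDr lerDl exprn_ge0.
Qed.

(** Bernoulli twice: [bump n v] is at least [1 - n%:R * (2 * v) ^+ n], and its product with the same
    power of [1 + v ^+ n], which is at least [n.+1] when [v >= 1/2], is at most 1. *)
Lemma bump_cvg v : 0 <= v <= 1 ->
  bump n v @[n --> \oo] --> ((v < 2^-1)%R%:R : R).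
Proof.
move=> /[dup] v01 /andP[v0 v1].
have two0 : (0 : R) < 2 by [].
have vn0 n : 0 <= v ^+ n by exact: exprn_ge0.
have vn1 n : v ^+ n <= 1 by exact: exprn_ile1.
have [v2|v2] := ltP v 2^-1.
  have lower n : 1 - n%:R * (2 * v) ^+ n <= bump n v.
    rewrite exprMn mulrA -natrX -natrM /bump; move: (n * 2 ^ n)%N => N.
    elim: N => [|N IHN]; first by rewrite mul0r subr0 expr0.
    rewrite exprSr -natr1; have := vn0 n; have := vn1 n; move: IHN.
    have := exprn_ge0 N (_ : 0 <= 1 - v ^+ n); rewrite subr_ge0 => /(_ (vn1 n)).
    have : (1 - v ^+ n) ^+ N <= 1.
      by rewrite exprn_ile1 ?subr_ge0// lerBlDr lerDl.
    by move: ((1 - v ^+ n) ^+ N) (v ^+ n) (N%:R : R) => A B C; nra.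
  apply: (@squeeze_cvgr _ _ _ _ (fun n => 1 - n%:R * (2 * v) ^+ n) (cst 1)).
  - by near=> n; rewrite lower; have /andP[] := bump_itv n v01.
  - rewrite -[X in _ --> X]subr0; apply: cvgB; first exact: cvg_cst.
    apply: cvg_natM_expr; rewrite mulr_ge0//=.
    by rewrite -ltr_pdivlMl// mulr1.
  - exact: cvg_cst.
have upper n : bump n v <= n.+1%:R^-1.
  have low : n.+1%:R <= (1 + v ^+ n) ^+ (n * 2 ^ n).
    apply: (@le_trans _ _ (1 + (n * 2 ^ n)%:R * v ^+ n)).
      rewrite -natr1 addrC lerD2l natrM -mulrA ler_peMr// natrX -exprMn.
      by rewrite exprn_ege1// -ler_pdivrMl// mulr1.
    move: (n * 2 ^ n)%N => N; elim: N => [|N IHN].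
      by rewrite mul0r addr0 expr0.
    rewrite exprSr -natr1; have := vn0 n; move: IHN.
    by move: ((1 + v ^+ n) ^+ N) (v ^+ n) => A B; have := ler0n R N; nra.
  rewrite -[leRHS]mul1r ler_pdivlMr ?ltr0n//.
  apply: (@le_trans _ _ (bump n v * (1 + v ^+ n) ^+ (n * 2 ^ n))).
    by rewrite ler_wpM2l//; have /andP[] := bump_itv n v01.
  rewrite -exprMn exprn_ile1// ?mulr_ge0 ?subr_ge0 ?addr_ge0//.
  by have := vn0 n; have := vn1 n; move: (v ^+ n) => A; nra.
apply: (@squeeze_cvgr _ _ _ _ (cst 0) (fun n => n.+1%:R^-1)).
- by near=> n; rewrite upper andbT; have /andP[] := bump_itv n v01.
- exact: cvg_cst.
- exact: cvg_harmonic.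
Unshelve. all: by end_near. Qed.

(** Once [x / k.+1%:R] lies in the interval from [-pi] to [pi], its sine is positive exactly when
    [x] is. *)
Lemma sin_step_cvg x : ((0 < sin (x / k.+1%:R))%R%:R : R) @[k --> \oo] -->
  ((0 < x)%R%:R : R).
Proof.
apply: cvg_near_cst; near=> k.
have k0 : (0 : R) < k.+1%:R by [].
have xk : `|x / k.+1%:R| < pi.
  rewrite normrM normfV (gtr0_norm k0) ltr_pdivrMr//.
  apply: (@lt_le_trans _ _ k.+1%:R); last first.
    by rewrite ler_peMl ?(ltW k0)// (le_trans _ (pi_ge2 R))// ler1n.
  near: k; exists (Num.truncn `|x|) => // k /= xk.
  by rewrite (lt_le_trans (truncnS_gt _))// ler_nat.
move: xk; rewrite ltr_norml => /andP[lo hi]; congr (_%:R).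
have [x0|x0] := ltP 0 x; first by rewrite sin_gt0_pi// divr_gt0.
have : 0 <= sin (- (x / k.+1%:R)).
  apply: sin_ge0_pi; rewrite oppr_ge0 pmulr_lle0 ?invr_gt0// x0 /=.
  by rewrite lerNl ltW.
by rewrite sinN oppr_ge0 => sx; rewrite ltNge sx.
Unshelve. all: by end_near. Qed.

End StepApproximation.

(** * The Cramer-Wold device *)

Section LawOfFamilies.
Context d (T : measurableType d) (R : realType) (P : probability T R).
Variable I : choiceType.
Implicit Types (phi psi : (I -> R) -> R) (X Y : T -> I -> R).

Definition lincomb (s : seq (I * R)) (x : I -> R) : R :=
  \sum_(p <- s) p.2 * x p.1.

(** A real substitute for characteristic functions: by the product-to-sum formula these functions
    form an algebra, although their means only involve laws of single linear combinations. *)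
Inductive trig_poly : ((I -> R) -> R) -> Prop :=
| TrigCos s th : trig_poly (fun x => cos (lincomb s x + th))
| TrigLin c phi psi : trig_poly phi -> trig_poly psi ->
    trig_poly (fun x => c * phi x + psi x).

Lemma eq_trig_poly phi psi : phi =1 psi -> trig_poly phi -> trig_poly psi.
Proof. by move=> /funext ->. Qed.

Lemma trig_poly_cst c : trig_poly (cst c).
Proof.
have t1 : trig_poly (cst 1).
  apply: eq_trig_poly (TrigCos [::] 0) => x.
  by rewrite /lincomb big_nil addr0 cos0.
apply: eq_trig_poly (TrigLin (c - 1) t1 t1) => x.
by rewrite /= mulr1 subrK.
Qed.

Lemma trig_polyZ c phi : trig_poly phi -> trig_poly (fun x => c * phi x).
Proof.
move=> tphi; apply: eq_trig_poly (TrigLin c tphi (trig_poly_cst 0)) => x.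
by rewrite addr0.
Qed.

Lemma trig_polyM phi psi : trig_poly phi -> trig_poly psi ->
  trig_poly (fun x => phi x * psi x).
Proof.
move=> tphi; elim: tphi psi => [s th|c phi1 phi2 _ IH1 _ IH2] psi tpsi; last first.
  apply: eq_trig_poly (TrigLin c (IH1 _ tpsi) (IH2 _ tpsi)) => x.
  by rewrite mulrDl mulrA.
elim: tpsi => [s' th'|c psi1 psi2 _ IH1 _ IH2]; last first.
  by apply: eq_trig_poly (TrigLin c IH1 IH2) => x; rewrite mulrDr mulrCA.
pose opp_s := [seq (p.1, - p.2) | p <- s'].
have oppE x : lincomb opp_s x = - lincomb s' x.
  by rewrite /lincomb big_map -sumrN; apply: eq_bigr => p _; rewrite mulNr.
have catE s1 s2 x : lincomb (s1 ++ s2) x = lincomb s1 x + lincomb s2 x.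
  by rewrite /lincomb big_cat.
apply: eq_trig_poly (trig_polyZ 2^-1 (TrigLin 1 (TrigCos (s ++ s') (th + th'))
   (TrigCos (s ++ opp_s) (th - th')))) => x.
rewrite !catE oppE mul1r; set A := lincomb s x; set B := lincomb s' x.
have -> : A + B + (th + th') = (A + th) + (B + th') by ring.
have -> : A - B + (th - th') = (A + th) - (B + th') by ring.
by rewrite cosD cosB; field.
Qed.

Lemma trig_polyX phi n : trig_poly phi -> trig_poly (fun x => phi x ^+ n).
Proof.
move=> tphi; elim: n => [|n IHn]; first exact: trig_poly_cst.
by apply: eq_trig_poly (trig_polyM tphi IHn) => x; rewrite exprS.
Qed.

Lemma trig_poly_prod (J : Type) (s : seq J) (F : J -> (I -> R) -> R) :
  (forall j, trig_poly (F j)) -> trig_poly (fun x => \prod_(j <- s) F j x).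
Proof.
move=> tF; elim: s => [|j s IHs].
  by apply: eq_trig_poly (trig_poly_cst 1) => x; rewrite big_nil.
by apply: eq_trig_poly (trig_polyM (tF j) IHs) => x; rewrite big_cons.
Qed.

Lemma trig_poly_bump n k (p : I * R) :
  trig_poly (fun x => bump n ((1 - sin ((x p.1 - p.2) / k.+1%:R)) / 2)).
Proof.
have ts : trig_poly (fun x => sin ((x p.1 - p.2) / k.+1%:R)).
  apply: eq_trig_poly (TrigCos [:: (p.1, k.+1%:R^-1)] (- (p.2 / k.+1%:R)
    - pi / 2)) => x.
  by rewrite /lincomb big_seq1 addrA cosBpihalf mulrBl [_^-1 * _]mulrC.
have tv : trig_poly (fun x => (1 - sin ((x p.1 - p.2) / k.+1%:R)) / 2).
  apply: eq_trig_poly (TrigLin (- 2^-1) ts (trig_poly_cst 2^-1)) => x.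
  by rewrite /cst; field.
apply: trig_polyX; apply: eq_trig_poly (TrigLin (-1) (trig_polyX n tv)
  (trig_poly_cst 1)) => x.
by rewrite /= mulN1r addrC.
Qed.

Definition same_mean X Y phi :=
  [/\ measurable_fun setT (fun w => phi (X w)),
      measurable_fun setT (fun w => phi (Y w)),
      exists M, forall x, `|phi x| <= M &
      (\int[P]_w (phi (X w))%:E = \int[P]_w (phi (Y w))%:E)%E].

Lemma bounded_integrable (g : T -> R) M : measurable_fun setT g ->
  (forall w, `|g w| <= M) -> P.-integrable setT (EFin \o g).
Proof.
move=> mg gM; apply: measurable_bounded_integrable => //.
  by rewrite -ge0_fin_numE// fin_num_measure.
exists M; split; first exact: num_real.
by move=> r Mr w _ /=; apply: le_trans (gM w) (ltW Mr).
Qed.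

Lemma same_mean_lim X Y (phi_ : nat -> (I -> R) -> R) phi :
  (forall n, same_mean X Y (phi_ n)) -> (forall n x, `|phi_ n x| <= 1) ->
  (forall x, phi_ n x @[n --> \oo] --> phi x) -> same_mean X Y phi.
Proof.
move=> same bnd cvg.
have mlim (Z : T -> I -> R) : (forall n, measurable_fun setT (fun w =>
  phi_ n (Z w))) ->
    measurable_fun setT (fun w => phi (Z w)).
  move=> mZ; apply: (@measurable_fun_cvg _ _ _ setT (fun n w => phi_ n (Z w))) => //.
have ilim (Z : T -> I -> R) : (forall n, measurable_fun setT (fun w =>
  phi_ n (Z w))) ->
    (\int[P]_w (phi_ n (Z w))%:E @[n --> \oo] --> \int[P]_w (phi (Z w))%:E)%E.
  move=> mZ; have := @dominated_convergence _ T R P setT measurableT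
    (fun n w => (phi_ n (Z w))%:E) (fun w => (phi (Z w))%:E) (cst 1%E).
  case=> //.
  - by move=> n; apply/measurable_EFinP.
  - by apply/measurable_EFinP; exact: mlim.
  - by apply: aeW => w _; apply: cvg_EFin; [exact: nearW|exact: cvg].
  - by apply: (@bounded_integrable (cst 1) 1) => // w; rewrite normr1.
  - by apply: aeW => w n _; rewrite lee_fin.
split.
- by apply: mlim => n; case: (same n).
- by apply: mlim => n; case: (same n).
- exists 1 => x; have := cvg x => /cvg_norm cn.
  rewrite -(cvg_lim _ cn)//; apply: limr_le; first by apply/cvg_ex; exists `|phi x|.
  exact: nearW.
- have mX n : measurable_fun setT (fun w => phi_ n (X w)) by case: (same n).
  have mY n : measurable_fun setT (fun w => phi_ n (Y w)) by case: (same n).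
  have eXY n : (\int[P]_w (phi_ n (X w))%:E = \int[P]_w (phi_ n (Y w))%:E)%E.
    by case: (same n).
  have := ilim X mX; under eq_fun do rewrite eXY.
  by move=> XY; apply: cvg_unique XY _ => //; exact: ilim.
Qed.

Definition upper_orthant (s : seq (I * R)) : set (I -> R) :=
  [set x | forall p, p \in s -> p.2 < x p.1].

Lemma upper_orthant_prod s x :
  \prod_(p <- s) ((0 < x p.1 - p.2)%R%:R : R) = \1_(upper_orthant s) x.
Proof.
rewrite indicE; have [xs|xs] := boolP (x \in upper_orthant s).
  rewrite big_seq big1// => p /(set_mem xs); by rewrite -subr_gt0 => ->.
apply/eqP; rewrite prodf_seq_eq0; apply/hasP.
move/negP: xs => /(contra_not (@mem_set _ _ _)) /existsNP[p /not_implyP[ps xp]].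
by exists p => //=; rewrite pnatr_eq0 eqb0 subr_gt0; apply/negP.
Qed.

Lemma cvg_prod_seq (J : eqType) (s : seq J) (F : nat -> J -> R) (G : J -> R) :
  (forall j, F n j @[n --> \oo] --> G j) ->
  \prod_(j <- s) F n j @[n --> \oo] --> \prod_(j <- s) G j.
Proof.
move=> FG; elim: s => [|j s IHs].
  by rewrite big_nil; under eq_fun do rewrite big_nil; exact: cvg_cst.
by rewrite big_cons; under eq_fun do rewrite big_cons; exact: cvgM.
Qed.

Lemma prod_itv (J : eqType) (s : seq J) (F : J -> R) :
  (forall j, 0 <= F j <= 1) -> `|\prod_(j <- s) F j| <= 1.
Proof.
move=> F01; rewrite normr_prod; apply: prodr_ile1 => j _.
by have /andP[F0 F1] := F01 j; rewrite normr_ge0 ger0_norm.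
Qed.

Section EqualLaws.
Variables X Y : T -> I -> R.
Hypothesis mX : forall i, measurable_fun setT (fun w => X w i).
Hypothesis mY : forall i, measurable_fun setT (fun w => Y w i).
Hypothesis XY : forall s (A : set (measurableTypeR R)), measurable A ->
  P ((fun w => lincomb s (X w)) @^-1` A) = P ((fun w => lincomb s (Y w)) @^-1` A).

Lemma measurable_lincomb (Z : T -> I -> R) s :
  (forall i, measurable_fun setT (fun w => Z w i)) ->
  measurable_fun setT (fun w => lincomb s (Z w)).
Proof. by move=> mZ; apply: measurable_sum => p; exact: measurable_funM. Qed.

Lemma same_mean_trig phi : trig_poly phi -> same_mean X Y phi.
Proof.
elim=> [s th|c phi1 phi2 _ [m1X m1Y [M1 b1] e1] _ [m2X m2Y [M2 b2] e2]].
  have mcos : measurable_fun setT (fun y : measurableTypeR R => cos (y + th)).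
    apply: continuous_measurable_fun => y.
    apply: continuous_comp; last exact: continuous_cos.
    by apply: cvgD; [exact: cvg_id|exact: cvg_cst].
  (* Adding 1 makes the integrand nonnegative, as the change of variables in [law_measure] requires;
     it is subtracted at the end. *)
  have mcosE : measurable_fun setT (fun y : measurableTypeR R =>
    (1 + cos (y + th))%:E).
    by apply/measurable_EFinP; exact: measurable_funD.
  have mlX := measurable_lincomb s mX; have mlY := measurable_lincomb s mY.
  have mcX : measurable_fun setT (fun w => cos (lincomb s (X w) + th)).
    exact: (measurableT_comp mcos mlX).
  have mcY : measurable_fun setT (fun w => cos (lincomb s (Y w) + th)).
    exact: (measurableT_comp mcos mlY).
  split=> //; first by exists 1 => x; exact: cos_max.
  have [m [mE mI]] := @law_measure R _ _ T (measurableTypeR R) P _ mlX.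
  have [m' [mE' mI']] := @law_measure R _ _ T (measurableTypeR R) P _ mlY.
  have cos0 (y : R) : (0 <= (1 + cos (y + th))%:E)%E.
    by rewrite lee_fin -lerBlDl sub0r; have := cos_max (y + th);
      rewrite ler_norml => /andP[].
  have : (\int[P]_w (1 + cos (lincomb s (X w) + th))%:E =
          \int[P]_w (1 + cos (lincomb s (Y w) + th))%:E)%E.
    rewrite -(mI (fun y => (1 + cos (y + th))%:E))//.
    rewrite -(mI' (fun y => (1 + cos (y + th))%:E))//.
    by apply: eq_measure_integral => A mA _; rewrite mE mE'; exact: XY.
  have i1 : P.-integrable setT (EFin \o cst (1 : R)).
    by apply: (@bounded_integrable _ 1) => // w; rewrite /= normr1.
  under eq_integral do rewrite EFinD.
  under [in RHS]eq_integral do rewrite EFinD.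
  rewrite !integralD//; last 2 first.
  - by apply: (@bounded_integrable _ 1) => // w; exact: cos_max.
  - by apply: (@bounded_integrable _ 1) => // w; exact: cos_max.
  rewrite !integral_cst//= probability_setT mul1e ![(1 + _)%E]addeC.
  by move=> /(congr1 (fun z => z - 1)%E); rewrite !addeK.
have i1X : P.-integrable setT (fun w => (phi1 (X w))%:E).
  exact: (bounded_integrable m1X (fun w => b1 (X w))).
have i1Y : P.-integrable setT (fun w => (phi1 (Y w))%:E).
  exact: (bounded_integrable m1Y (fun w => b1 (Y w))).
have i2X : P.-integrable setT (fun w => (phi2 (X w))%:E).
  exact: (bounded_integrable m2X (fun w => b2 (X w))).
have i2Y : P.-integrable setT (fun w => (phi2 (Y w))%:E).
  exact: (bounded_integrable m2Y (fun w => b2 (Y w))).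
split.
- by apply: measurable_funD => //; exact: measurable_funM.
- by apply: measurable_funD => //; exact: measurable_funM.
- exists (`|c| * M1 + M2) => x; apply: le_trans (ler_normD _ _) _.
  by rewrite normrM lerD// ler_wpM2l.
- under eq_integral do rewrite EFinD EFinM.
  under [in RHS]eq_integral do rewrite EFinD EFinM.
  rewrite !integralD// ?integralZl ?e1 ?e2//; exact: integrableZl.
Qed.

(** Two successive limits: in [n], [bump] tends to the indicator of a positive sine; in [k], the
    latter tends to the indicator of a positive argument. *)
Lemma same_mean_orthant s : same_mean X Y (\1_(upper_orthant s)).
Proof.
pose v k (p : I * R) (x : I -> R) : R := (1 - sin ((x p.1 - p.2) / k.+1%:R)) / 2.
have v01 k p x : 0 <= v k p x <= 1.
  have := sin_max ((x p.1 - p.2) / k.+1%:R); rewrite ler_norml /v.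
  by move: (sin _) => S /andP[? ?]; apply/andP; split; lra.
apply: (@same_mean_lim _ _ (fun k x => \prod_(p <- s)
    ((0 < sin ((x p.1 - p.2) / k.+1%:R))%R%:R : R))).
- move=> k; apply: (@same_mean_lim _ _ (fun n x => \prod_(p <- s) bump n (v k p x))).
  + by move=> n; apply: same_mean_trig; apply: trig_poly_prod => p;
    exact: trig_poly_bump.
  + by move=> n x; apply: prod_itv => p; exact: bump_itv.
  + move=> x; apply: cvg_prod_seq => p; have := bump_cvg (v01 k p x).
    suff -> : (v k p x < 2^-1) = (0 < sin ((x p.1 - p.2) / k.+1%:R)) by [].
    by rewrite /v; move: (sin _) => S; apply/idP/idP => ?; lra.
- by move=> k x; apply: prod_itv => p; case: (_ < _); rewrite /= ?lexx ?ler01.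
- move=> x; rewrite -upper_orthant_prod; apply: cvg_prod_seq => p.
  exact: sin_step_cvg.
Qed.

Definition orthants : set (set (I -> R)) := range upper_orthant.

Lemma upper_orthantE s : upper_orthant s =
  \bigcap_(p in [set` s]) [set x | p.2 < x p.1].
Proof. by apply/seteqP; split. Qed.

Lemma measurable_orthant_preimage (Z : T -> I -> R) s :
  (forall i, measurable_fun setT (fun w => Z w i)) ->
  measurable (Z @^-1` upper_orthant s).
Proof.
move=> mZ; rewrite upper_orthantE preimage_bigcap.
apply: fin_bigcap_measurable; first exact: finite_seq.
move=> p _; have := mZ p.1 measurableT `]p.2, +oo[%classic (measurable_itv _).
rewrite setTI; congr measurable; apply/seteqP.
by split=> w; rewrite /= in_itv /= andbT.
Qed.

(* Indicators of orthants are bounded limits of trigonometric polynomials, whose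
   means only depend on the laws of linear combinations. *)
Lemma eq_lincomb_eq_law (E : set (I -> R)) : <<s orthants >> E ->
  [/\ measurable (X @^-1` E), measurable (Y @^-1` E) &
      P (X @^-1` E) = P (Y @^-1` E)].
Proof.
move=> sE; pose OT := g_sigma_algebraType orthants.
have meas (Z : T -> I -> R) : (forall i, measurable_fun setT (fun w => Z w i)) ->
    measurable_fun setT (Z : T -> OT).
  move=> mZ; apply: (@measurability _ _ T OT setT Z orthants) => // _ [_ [s _ <-] <-].
  by rewrite setTI; exact: measurable_orthant_preimage.
split; first by have := meas _ mX measurableT E sE; rewrite setTI.
  by have := meas _ mY measurableT E sE; rewrite setTI.
have [m [mE _]] := @law_measure R _ _ T OT P _ (meas _ mX).
have [m' [mE' _]] := @law_measure R _ _ T OT P _ (meas _ mY).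
rewrite -mE -mE'.
have Om : orthants `<=` (@measurable _ OT) by exact: sub_sigma_algebra.
refine (@g_sigma_algebra_measure_unique _ R OT _ Om (fun=> setT) _ _ m m' _ _ _ E sE).
(* Orthants form a pi-system: the empty list gives the whole space and concatenation gives
   intersections. *)
- by move=> _; exists [::] => //; apply/seteqP; split.
- by apply/seteqP; split=> // x _; exists 0%N.
- move=> _ _ [s _ <-] [t _ <-]; exists (s ++ t) => //.
  apply/seteqP; split=> x /=.
    by move=> xst; split=> p ps; apply: xst; rewrite mem_cat ps ?orbT.
  by move=> [xs xt] p; rewrite mem_cat => /orP[/xs|/xt].
- move=> _ [s _ <-]; rewrite mE mE'.
  have [_ _ _] := same_mean_orthant s.
  have indE (Z : T -> I -> R) : (forall i, measurable_fun setT (fun w => Z w i)) ->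
      (\int[P]_w (\1_(upper_orthant s) (Z w))%:E = P (Z @^-1` upper_orthant s))%E.
    move=> mZ; rewrite -(setIT (Z @^-1` _)) -integral_indic//.
    exact: measurable_orthant_preimage.
  by rewrite !indE.
- by move=> _; rewrite mE preimage_setT -ge0_fin_numE// fin_num_measure.
Qed.

End EqualLaws.

End LawOfFamilies.

(** * Translation invariance of Lebesgue measure and of square integrability *)

Section Translation.
Variable R : realType.
Local Notation mR := (measurableTypeR R).
Local Notation mu := (@lebesgue_measure R).

Lemma lebesgue_measure_translate (c : R) (A : set mR) : measurable A ->
  mu ((fun x : mR => x + c : mR) @^-1` A) = mu A.
Proof.
have ms : measurable_fun setT (fun x : mR => x + c : mR).
  by apply: measurable_funD => //; exact: measurable_id.
have [m [mE _]] := law_measure mu ms.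
move=> mA; rewrite -mE; apply/esym; apply: lebesgue_measure_unique => //.
move=> _ [[a b] _ <-]; rewrite mE /=.
rewrite (_ : _ @^-1` _ = `]a - c, b - c]%classic); last first.
  by apply/seteqP; split=> x; rewrite /= !in_itv /= ltrBlDr lerBrDr.
by rewrite !lebesgue_measure_itv /= !lte_fin ltrD2r -!EFinB opprB addrA subrK.
Qed.

Definition tuple_shift d (c : 'I_d -> R) (t : d.-tuple mR) : d.-tuple mR :=
  [tuple (tnth t i + c i : mR) | i < d].

Lemma measurable_tuple_shift d (c : 'I_d -> R) :
  measurable_fun setT (tuple_shift c).
Proof.
apply/measurable_fun_tnthP => i.
rewrite (_ : _ \o _ = fun t => (tnth t i : R) + c i); last first.
  by apply/funext => t; rewrite /= tnth_mktuple.
by apply: measurable_funD => //; exact: measurable_tnth.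
Qed.

Lemma lebesgueRdS d (A : set (d.+1.-tuple mR)) :
  lebesgueRd R d.+1 A =
  (\int[mu]_x lebesgueRd R d (xsection (@cons_pair R d @^-1` A) x))%E.
Proof. by []. Qed.

(** Induction on the dimension: the sections are shifted by the induction hypothesis, the first
    coordinate by the one-dimensional case. *)
Lemma lebesgueRd_translate d (c : 'I_d -> R) (A : set (d.-tuple mR)) :
  measurable A -> lebesgueRd R d (tuple_shift c @^-1` A) = lebesgueRd R d A.
Proof.
elim: d c A => [|d IHd] c A mA.
  by congr (lebesgueRd R 0 _); apply/seteqP; split=> t /=;
    rewrite !(tuple0 (tuple_shift c t)) !(tuple0 t).
pose c' i := c (lift ord0 i).
pose B := @cons_pair R d @^-1` A.
have mB : measurable B.
  by rewrite -[B]setTI; exact: measurable_cons_pair.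
rewrite !lebesgueRdS -/B.
have -> : @cons_pair R d @^-1` (tuple_shift c @^-1` A) =
    [set p | B (p.1 + c ord0, tuple_shift c' p.2)].
  suff E p : tuple_shift c (cons_pair p) = cons_pair (p.1 +
    c ord0, tuple_shift c' p.2).
    by apply/seteqP; split=> p /=; rewrite /B /= E.
  apply: eq_from_tnth => i; rewrite tnth_mktuple.
  case: (unliftP ord0 i) => [j|] -> /=.
    by rewrite !tnthS tnth_mktuple.
  by rewrite !tnth0.
under eq_integral => x _.
  rewrite /= (_ : xsection _ x = tuple_shift c' @^-1` xsection B (x + c ord0)).
    rewrite IHd; last exact: measurable_xsection.
    over.
  by apply/seteqP; split=> t /=; rewrite /xsection /= !inE.
have [m [mE mI]] : exists m : {measure set mR -> \bar R},
  (forall S, m S = mu ((fun x : mR => x + c ord0 : mR) @^-1` S)) /\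
  (forall f : mR -> \bar R, measurable_fun setT f -> (forall y, 0 <= f y)%E ->
      (\int[m]_y f y = \int[mu]_x f (x + c ord0)%R)%E).
  by apply: law_measure; apply: measurable_funD => //; exact: measurable_id.
rewrite -(mI (fun x => lebesgueRd R d (xsection B x))).
- by apply: eq_measure_integral => S mS _; rewrite mE;
  exact: lebesgue_measure_translate.
- exact: measurable_fun_xsection.
- by move=> y; exact: measure_ge0.
Qed.

Lemma integral_tuple_shift d (c : 'I_d -> R) (f : d.-tuple mR -> \bar R) :
  measurable_fun setT f ->
  (\int[lebesgueRd R d]_t f (tuple_shift c t) = \int[lebesgueRd R d]_t f t)%E.
Proof.
have ge0 (g : d.-tuple mR -> \bar R) : measurable_fun setT g ->
    (forall t, 0 <= g t)%E ->
    (\int[lebesgueRd R d]_t g (tuple_shift c t) = \int[lebesgueRd R d]_t g t)%E.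
  move=> mg g0.
  have [m [mE mI]] := law_measure (lebesgueRd R d) (measurable_tuple_shift c).
  rewrite -mI//; apply: eq_measure_integral => S mS _.
  by rewrite mE; exact: lebesgueRd_translate.
move=> mf; rewrite integralE [RHS]integralE; congr (_ - _)%E.
  transitivity (\int[lebesgueRd R d]_t (f^\+ (tuple_shift c t)))%E.
    by apply: eq_integral => t _; rewrite !funeposE.
  by apply: ge0 => //; exact: measurable_funepos.
transitivity (\int[lebesgueRd R d]_t (f^\- (tuple_shift c t)))%E.
  by apply: eq_integral => t _; rewrite !funenegE.
by apply: ge0 => //; exact: measurable_funeneg.
Qed.

Lemma vec_tuple_shift d (x : 'rV[R]_d) t :
  vec (tuple_shift (x 0) t) = vec t + x.
Proof. by apply/rowP => i; rewrite !mxE tnth_mktuple. Qed.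

Lemma integralRd_translate d (g : 'rV[R]_d -> R) x :
  measurable_fun setT (g \o @vec R d) ->
  integralRd (fun y => g (y + x)) = integralRd g.
Proof.
move=> mg; rewrite /integralRd /Rintegral; congr fine.
under eq_integral do rewrite -vec_tuple_shift.
by rewrite (integral_tuple_shift _ (f := fun t => (g (vec t))%:E))//;
  exact/measurable_EFinP.
Qed.

Lemma L2_translate d (g : 'rV[R]_d -> R) x : L2 g -> L2 (fun y => g (y + x)).
Proof.
move=> /andP[mg ng]; have {}mg := set_mem mg; have {}ng := set_mem ng.
have E : (fun y => g (y + x)) \o @vec R d = (g \o @vec R d) \o tuple_shift (x 0).
  by apply/funext => t; rewrite /= vec_tuple_shift.
have mgx : measurable_fun setT ((g \o @vec R d) \o tuple_shift (x 0)).
  exact: (measurableT_comp mg (measurable_tuple_shift _)).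
apply/andP; rewrite E; split; apply/mem_set => //=.
move: ng; rewrite /= /finite_norm unlock /=.
rewrite (integral_tuple_shift (x 0) (f := fun t => (`|g (vec t)| `^ 2)%:E))//.
apply/measurable_EFinP; rewrite (_ : (fun _ => _) = fun t => g (vec t) ^+ 2).
  exact: measurable_funX.
by apply/funext => t; rewrite powR_mulrn// real_normK// num_real.
Qed.

End Translation.

(** * Invariance of the law of the field under translation and sign change *)

Section GaussianFieldLaw.
Context (d : nat) (disp : measure_display) (T : measurableType disp) (R : realType).
Variables (P : probability T R) (W : ('rV[R]_d -> R) -> T -> R).
Hypothesis hW : white_noise P W.

Lemma ae_eq_law (X Y : T -> R) : measurable_fun setT X -> measurable_fun setT Y ->
  {ae P, forall w, X w = Y w} ->
  forall A : set (measurableTypeR R), measurable A -> P (X @^-1` A) = P (Y @^-1` A).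
Proof.
move=> mX mY XY A mA.
have mXA : measurable (X @^-1` A) by rewrite -[_ @^-1` _]setTI; exact: mX.
have mYA : measurable (Y @^-1` A) by rewrite -[_ @^-1` _]setTI; exact: mY.
rewrite -(setIT (X @^-1` A)) -(setIT (Y @^-1` A)) -!integral_indic//.
apply: ae_eq_integral => //.
- by apply/measurable_EFinP; exact: measurable_indic.
- by apply/measurable_EFinP; exact: measurable_indic.
- apply: filterS XY => w Xw _; rewrite !indicE; congr (_%:R%:E).
  by congr nat_of_bool; apply/idP/idP => /set_mem Aw; apply/mem_set; move: Aw;
    rewrite /= Xw.
Qed.

Lemma white_noise_measurable g : L2 g -> measurable_fun setT (W g).
Proof.
move=> gL2; have [+ _] := white_noise_gaussian hW (g := fun _ : 'I_1 => g) (fun=>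
  1) (fun=> gL2).
by under eq_fun do rewrite big_ord1 mul1r.
Qed.

Lemma white_noise_Lfun g : L2 g -> W g \in Lfun P 2%:E.
Proof.
move=> gL2; have mWg := white_noise_measurable gL2.
apply/andP; split; apply/mem_set => //=; rewrite /finite_norm unlock /=.
apply: poweR_lty; under eq_integral do rewrite powR_mulrn// real_normK ?num_real//.
have := white_noise_cov hW gL2 gL2; rewrite unlock /= => ->.
exact: ltry.
Qed.

Lemma expectation_sum_Lfun (J : Type) (s : seq J) (F : J -> T -> R) :
  (forall j, F j \in Lfun P 1) ->
  (fun w => \sum_(j <- s) F j w) \in Lfun P 1 /\
  expectation P (fun w => \sum_(j <- s) F j w) =
    (\sum_(j <- s) expectation P (F j))%E.
Proof.
move=> LF; elim: s => [|j s [IH1 IH2]].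
  under eq_fun do rewrite big_nil.
  split; last by rewrite big_nil; exact: expectation_cst.
  exact: rpred0.
under eq_fun do rewrite big_cons; split; first by apply: rpredD.
by rewrite big_cons -IH2 -expectationD.
Qed.

Variable (q : 'rV[R]_d -> R) (f : T -> 'rV[R]_d -> R).
Hypothesis hf : moving_average P W q f.
Let h (x y : 'rV[R]_d) : R := q (x - y).
Let K (x x' : 'rV[R]_d) : R := integralRd (fun y => h x y * h x' y).
Implicit Types (s : seq ('rV[R]_d * R)) (x z : 'rV[R]_d).

Lemma kernel_shiftE x : h x = fun y => q (y - x).
Proof. by apply/funext => y; rewrite /h -(kernel_even hf) opprB. Qed.

Lemma L2_kernel_shift x : L2 (h x).
Proof. by rewrite kernel_shiftE; exact: L2_translate (kernel_L2 hf). Qed.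

Lemma covariance_stationary z x x' : K (x + z) (x' + z) = K x x'.
Proof.
pose G y := h x y * h x' y.
have mG : measurable_fun setT (G \o @vec R d).
  apply: measurable_funM.
    by have /andP[/set_mem] := L2_kernel_shift x.
  by have /andP[/set_mem] := L2_kernel_shift x'.
rewrite /K -(integralRd_translate (- z) mG); congr integralRd.
apply/funext => y; rewrite /G /h opprD opprK addrA.
by rewrite (addrAC x) (addrAC x') (addrA x') (addrAC x' (- y)).
Qed.

Definition noise_sum s (w : T) : R := \sum_(p <- s) p.2 * W (h p.1) w.

Lemma noise_sum_gaussian s : centred_gaussian P (noise_sum s).
Proof.
rewrite /noise_sum; under eq_fun do rewrite big_tnth.
exact: (white_noise_gaussian hW (g := fun i => h (tnth (in_tuple s) i).1)
  (fun i => (tnth (in_tuple s) i).2) (fun i => L2_kernel_shift _)).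
Qed.

Lemma noise_sum_second_moment s :
  (\int[P]_w (noise_sum s w ^+ 2)%:E =
   (\sum_(p <- s) \sum_(p' <- s) p.2 * p'.2 * K p.1 p'.1)%:E)%E.
Proof.
pose F (p p' : 'rV[R]_d * R) w := p.2 * p'.2 * (W (h p.1) w * W (h p'.1) w).
have LW p p' : (fun w => W (h p) w * W (h p') w) \in Lfun P 1.
  by apply: Lfun2_mul_Lfun1; exact/white_noise_Lfun/L2_kernel_shift.
have LF p p' : F p p' \in Lfun P 1 by exact: (rpredZ (p.2 * p'.2) (LW p.1 p'.1)).
have EF p p' : expectation P (F p p') = (p.2 * p'.2 * K p.1 p'.1)%:E.
  have -> : F p p' = (p.2 * p'.2) \o* (fun w => W (h p.1) w * W (h p'.1) w).
    by apply/funext => w; rewrite /F /= mulrC.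
  rewrite expectationZl// (white_noise_cov hW); try exact: L2_kernel_shift.
  by rewrite EFinM.
transitivity (expectation P (fun w => \sum_(p <- s) \sum_(p' <- s) F p p' w)).
  rewrite unlock; apply: eq_integral => w _; congr EFin.
  rewrite /noise_sum expr2 big_distrlr /=.
  by apply: eq_bigr => p _; apply: eq_bigr => p' _; rewrite /F mulrACA.
have inner p := expectation_sum_Lfun s (LF p).
have [_ ->] := expectation_sum_Lfun s (fun p => (inner p).1).
rewrite -sumEFin; apply: eq_bigr => p _; rewrite (inner p).2 -sumEFin.
by apply: eq_bigr => p' _; exact: EF.
Qed.

Lemma field_sum_ae s : {ae P, forall w,
  \sum_(p <- s) p.2 * f w p.1 = noise_sum s w}.
Proof.
rewrite /noise_sum; elim: s => [|p s IHs].
  by apply: aeW => w; rewrite !big_nil.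
have := field_conv hf p.1; apply: filterS2 IHs => w E1 E2.
by rewrite !big_cons E1 E2.
Qed.

Lemma measurable_field_sum s :
  measurable_fun setT (fun w => \sum_(p <- s) p.2 * f w p.1).
Proof.
apply: measurable_sum => p; apply: measurable_funM => //.
exact: (field_measurable hf).
Qed.

(** Both sums are almost surely noise sums, hence centred Gaussian. Their second moments agree,
    since the covariance is stationary and the two signs in each product cancel. *)
Lemma field_sum_symmetry s z (A : set (measurableTypeR R)) : measurable A ->
  P ((fun w => \sum_(p <- s) p.2 * f w (p.1 + z)) @^-1` A) =
  P ((fun w => \sum_(p <- s) p.2 * - f w p.1) @^-1` A).
Proof.
move=> mA; pose s1 := [seq (p.1 + z, p.2) | p <- s].
pose s2 := [seq (p.1, - p.2) | p <- s].
have -> : (fun w => \sum_(p <- s) p.2 * f w (p.1 + z)) =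
    fun w => \sum_(p <- s1) p.2 * f w p.1.
  by apply/funext => w; rewrite big_map.
have -> : (fun w => \sum_(p <- s) p.2 * - f w p.1) =
    fun w => \sum_(p <- s2) p.2 * f w p.1.
  by apply/funext => w; rewrite big_map; apply: eq_bigr => p _; rewrite mulrN mulNr.
have law s' : P ((fun w => \sum_(p <- s') p.2 * f w p.1) @^-1` A) =
    P (noise_sum s' @^-1` A).
  apply: ae_eq_law => //; last exact: field_sum_ae.
    exact: measurable_field_sum.
  by have [] := noise_sum_gaussian s'.
rewrite !law; apply: eq_second_moment_law => //.
- exact: noise_sum_gaussian.
- exact: noise_sum_gaussian.
- by rewrite noise_sum_second_moment ltry.
rewrite !noise_sum_second_moment; congr EFin; rewrite !big_map.
apply: eq_bigr => p _; rewrite !big_map; apply: eq_bigr => p' _ /=.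
by rewrite covariance_stationary mulrNN.
Qed.

Lemma field_law_symmetry (z : 'rV[R]_d) (E : set ('rV[rat]_d -> R)) :
  <<s @orthants R 'rV[rat]_d >> E ->
  [/\ measurable [set w | E (fun v => f w (rat_vec R v + z))],
      measurable [set w | E (fun v => - f w (rat_vec R v))] &
      P [set w | E (fun v => f w (rat_vec R v + z))] =
      P [set w | E (fun v => - f w (rat_vec R v))]].
Proof.
apply: (@eq_lincomb_eq_law _ _ _ P _ (fun w v => f w (rat_vec R v + z))
  (fun w v => - f w (rat_vec R v))).
- by move=> v; exact: (field_measurable hf).
- by move=> v; apply: measurableT_comp => //; exact: (field_measurable hf).
move=> s A mA.
have := field_sum_symmetry [seq (rat_vec R p.1, p.2) | p <- s] z mA.
rewrite /lincomb; under eq_fun do rewrite big_map.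
by under [in X in _ = X -> _]eq_fun do rewrite big_map.
Qed.

End GaussianFieldLaw.

(** * The union bound *)

(** There are countably many chains of rational balls, and each imposes countably many conditions on
    single values. *)
Lemma chain_event_measurable (R : realType) d (l : R) n :
  <<s @orthants R 'rV[rat]_d >> (chain_event l n).
Proof.
pose OT := g_sigma_algebraType (@orthants R 'rV[rat]_d).
have mle v : @measurable _ OT [set u | u v <= l].
  rewrite (_ : [set u | _] = ~` upper_orthant [:: (v, l)]); last first.
    apply/seteqP; split=> u /=.
      by move=> ul /(_ (v, l) (mem_head _ _)) /=; rewrite ltNge ul.
    move=> nu; rewrite leNgt; apply/negP => lu; apply: nu => p.
    by rewrite inE => /eqP ->.
  by apply: measurableC; apply: sub_sigma_algebra; exists [:: (v, l)].
pose Q (bs : ('rV[rat]_d * rat) * seq ('rV[rat]_d * rat)) :=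
  [/\ path (@overlap R d) bs.1 bs.2,
     (exists2 x : 'rV[R]_d, Lambda 1 x & rat_ball bs.1 x) &
     (exists2 y : 'rV[R]_d, n%:R <= `|y| & rat_ball (last bs.1 bs.2) y)].
pose G (bs : ('rV[rat]_d * rat) * seq ('rV[rat]_d * rat)) v :=
  exists2 c, c \in bs.1 :: bs.2 & rat_ball c (rat_vec R v).
have -> : chain_event l n = \bigcup_bs (if `[< Q bs >]
    then \bigcap_v (if `[< G bs v >] then [set u | u v <= l] else setT) else set0).
  apply/seteqP; split=> u.
    move=> [b [s [bs bx sy sl]]]; exists (b, s) => //.
    case: asboolP => [_ v _|[]]; last by split.
    by case: asboolP => // -[c cs cv]; exact: sl cs v cv.
  move=> [[b s] _]; case: asboolP => // -[/= bs bx sy] ul; exists b, s; split=> //.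
  move=> c cs v cv; have := ul v I; case: asboolP => // -[]; by exists c.
apply: (@countable_bigcupT_measurable _ OT _ _ _) => [|bs]; first exact: countableP.
case: asboolP => // _; rewrite -[X in measurable X]setCK setC_bigcap.
apply: measurableC; apply: (@countable_bigcupT_measurable _ OT _ _ _).
  exact: countableP.
by move=> v; apply: measurableC; case: asboolP => // _; exact: mle.
Qed.

Lemma measure_bigsetU_le d (T : measurableType d) (R : realType)
    (mu : {measure set T -> \bar R}) (J : Type) (s : seq J) (A : J -> set T) :
  (forall j, measurable (A j)) ->
  (mu (\big[setU/set0]_(j <- s) A j) <= \sum_(j <- s) mu (A j))%E.
Proof.
move=> mA; elim: s => [|j s IHs]; first by rewrite !big_nil measure0.
rewrite !big_cons (le_trans (measureU2 _ _ _))//.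
  exact: bigsetU_measurable.
exact: leeD2l.
Qed.

(** With [s = expR (- c / j.+1%:R)], the sequence is eventually at most the power [j.+1] of
    [n%:R * s ^+ n]. *)
Lemma cvg_natX_expR (R : realType) (c : R) j : 0 < c ->
  n%:R ^+ j * expR (- c * n%:R) @[n --> \oo] --> (0 : R).
Proof.
move=> c0; pose s := expR (- c / j.+1%:R).
have s1 : 0 <= s < 1.
  by rewrite expR_ge0 expR_lt1 mulNr oppr_lt0 divr_gt0.
have sj n : (n%:R * s ^+ n) ^+ j.+1 = n%:R ^+ j.+1 * expR (- c * n%:R).
  rewrite exprMn -exprM mulnC exprM /s -expRM_natl -expRM_natl mulr_natl.
  by congr (_ * expR _); rewrite mulrC mulfVK ?pnatr_eq0// mulr_natr.
apply: (@squeeze_cvgr _ _ _ _ (cst 0) (fun n => (n%:R * s ^+ n) ^+ j.+1)).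
- near=> n; rewrite mulr_ge0 ?exprn_ge0 ?expR_ge0//= sj ler_wpM2r ?expR_ge0//.
  have n1 : (1 : R) <= n%:R by rewrite ler1n; near: n; exists 1%N.
  by rewrite exprS ler_peMl ?exprn_ge0.
- exact: cvg_cst.
- have := cvg_comp _ _ (cvg_natM_expr s1) (@exprn_continuous R j.+1 0).
  by rewrite expr0n.
Unshelve. all: by end_near. Qed.

Section FiniteClusters.
Variables (R : realType) (d : nat).
Hypothesis d2 : (2 <= d)%N.
Variables (disp : measure_display) (T : measurableType disp) (P : probability T R).
Variables (W : ('rV[R]_d -> R) -> T -> R) (hW : white_noise P W).
Variables (q : 'rV[R]_d -> R) (f : T -> 'rV[R]_d -> R).
Hypothesis hf : moving_average P W q f.
Variables (l C c : R).
Hypotheses (C0 : 0 < C) (c0 : 0 < c).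
Hypothesis subcritical : forall n, (2 < n)%N ->
  (prob P [set w | joined (Lambda 1) (excursion (f w) (- l)) (boundary (Lambda n))]
   < (C * expR (- c * n%:R))%:E)%E.

Definition shifted_chain (x : 'I_d * bool) (n m : nat) : set T :=
  [set w | chain_event l (n + m)
    (fun v => f w (rat_vec R v + ((-1) ^+ x.2 * m%:R) *: delta_mx 0 x.1))].

Lemma discontinuity_null : exists2 N : set T, measurable N /\ P N = 0%E &
  forall w, ~ N w -> continuous (f w).
Proof.
have [N [mN N0 sN]] := field_continuous hf; exists N => // w nNw.
by apply: contrapT => ncf; apply: nNw; exact: sN.
Qed.

(** Replacing the translated field by [-f] turns the chain into a connection in the excursion set at
    level [-l], to which the subcritical bound at distance [n + m] applies. *)
Lemma shifted_chain_le x n m : (2 < n)%N ->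
  measurable (shifted_chain x n m) /\
  (P (shifted_chain x n m) <= (C * expR (- c * n%:R) * expR (- c) ^+ m)%:E)%E.
Proof.
move=> n2; have nm2 : (2 < n + m)%N by exact: leq_trans (leq_addr _ _).
have [mB mB' PB] := field_law_symmetry hW hf
  (((-1) ^+ x.2 * m%:R) *: delta_mx 0 x.1) (@chain_event_measurable R d l (n + m)).
split=> //; rewrite PB.
have [N [mN N0] cN] := discontinuity_null.
set B := [set w | chain_event l (n + m) (fun v => - f w (rat_vec R v))] in mB' *.
have -> : C * expR (- c * n%:R) * expR (- c) ^+ m = C * expR (- c * (n + m)%:R).
  by rewrite -mulrA -expRM_natl -expRD natrD mulrDr (mulrC (- c) m%:R).
apply: le_trans _ (ltW (subcritical nm2)).
(* Off the null set [N] the field is continuous; [B] without [N] is measurable, so its probability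
   is an outer probability, monotone with respect to the connection event. *)
apply: (@le_trans _ _ (P (B `\` N))).
  apply: (@le_trans _ _ (P ((B `\` N) `|` N))).
    apply: le_measure; rewrite ?inE//.
      by apply: measurableU => //; exact: measurableD.
    by move=> w Bw; have [Nw|Nw] := pselect (N w); [right|left].
  apply: le_trans (measureU2 _ _ _) _ => //; first exact: measurableD.
  by rewrite [X in (_ + X)%E](_ : _ = 0%E) ?adde0; last exact: N0.
rewrite -measurable_mu_extE; last exact: measurableD.
apply: le_mu_ext => w [Bw nNw] /=.
have cu : continuous (fun y => - f w y).
  by move=> y; exact: (@continuousN R R^o _ (f w) y (cN w nNw y)).
have := chain_event_joined (ltnW (ltnW nm2)) cu Bw.
congr joined; apply/seteqP; split=> y; rewrite /excursion /= lerNl //.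
Qed.

(** Union bound over the signed coordinate directions and the shifts [m]; the sum over [m] is a
    geometric series of ratio [expR (- c)]. *)
Lemma bounded_part_prob_le n : (2 < n)%N ->
  (prob P [set w | joined (Lambda 1) (bounded_part (excursion (f w) l))
                          (boundary (Lambda n))]
   <= ((C * expR (- c * n%:R)) *+ #|{: 'I_d * bool}| / (1 - expR (- c)))%:E)%E.
Proof.
move=> n2; have [N [mN N0] cN] := discontinuity_null.
have mB x m := (shifted_chain_le x m n2).1;
  have PB x m := (shifted_chain_le x m n2).2.
pose B m := \big[setU/set0]_(x : 'I_d * bool) shifted_chain x n m.
have mBm m : measurable (B m) by apply: bigsetU_measurable => x _; exact: mB.
have mUB : measurable (\bigcup_m B m) by exact: bigcupT_measurable.
set A := C * expR (- c * n%:R) in PB *.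
apply: (@le_trans _ _ (P (N `|` \bigcup_m B m))).
  rewrite /prob -[leRHS]measurable_mu_extE; last exact: measurableU.
  apply: le_mu_ext => w /= jw; have [Nw|nNw] := pselect (N w); [by left|right].
  have cw := cN w nNw.
  have [i [s [m [a [b [ab a1 bn]]]]]] :=
    bounded_cluster_surrounded d2 (ltnW (ltnW n2)) cw jw.
  exists m => //; rewrite /B -bigcup_seq; exists (i, s) => /=.
    by rewrite mem_index_enum.
  apply: (connected_chain_event (u := fun y =>
    f w (y + ((-1) ^+ s * m%:R) *: delta_mx 0 i)) _ ab a1 bn).
  have ct := @continuous_translate R 'rV[R]_d (((-1) ^+ s * m%:R) *: delta_mx 0 i).
  by move=> y; exact: (continuous_comp (ct y) (cw _)).
apply: le_trans (measureU2 _ _ _) _ => //.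
rewrite [X in (X + _)%E](_ : _ = 0%E) ?add0e; last exact: N0.
apply: le_trans (generalized_Boole_inequality _ mBm mUB) _.
pose z := expR (- c); have z0 : 0 < z by exact: expR_gt0.
have z1 : z < 1 by rewrite expR_lt1 oppr_lt0.
have A0 : 0 <= A *+ #|{: 'I_d * bool}| by rewrite mulrn_wge0// mulr_ge0 ?expR_ge0
  ?ltW.
have PBm m : (P (B m) <= (A *+ #|{: 'I_d * bool}| * z ^+ m)%:E)%E.
  apply: le_trans (measure_bigsetU_le _ _ (fun x => mB x m)) _.
  apply: le_trans (lee_sum _ (fun x _ => PB x m)) _.
  by rewrite sumEFin sumr_const -mulrnAl.
apply: lime_le; first exact: is_cvg_nneseries.
near=> k; apply: le_trans (lee_sum _ (fun m _ => PBm m)) _.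
rewrite sumEFin lee_fin.
have := geometric_le_lim k A0 z0 (_ : `|z| < 1); rewrite gtr0_norm// => /(_ z1).
by rewrite /series /=.
Unshelve. all: by end_near. Qed.

Lemma subcritical_superpolynomial_decay : superpolynomial_decay P f l.
Proof.
move=> j; pose K := C *+ #|{: 'I_d * bool}| / (1 - expR (- c)).
apply: (@squeeze_cvge _ _ _ _ (cst 0%E) _
  (fun n => (K * (n%:R ^+ j * expR (- c * n%:R)))%:E)).
- near=> n; apply/andP; split.
    by apply: mule_ge0; [rewrite lee_fin exprn_ge0|exact: mu_ext_ge0].
  have n2 : (2 < n)%N by near: n; exists 3%N.
  apply: (@le_trans _ _ ((n%:R ^+ j)%:E * ((C * expR (- c * n%:R))
    *+ #|{: 'I_d * bool}| / (1 - expR (- c)))%:E)%E).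
    by apply: lee_wpmul2l; [rewrite lee_fin exprn_ge0|exact: bounded_part_prob_le].
  rewrite -EFinM lee_fin le_eqVlt; apply/orP; left; apply/eqP; rewrite /K.
  rewrite -mulrnAl.
  move: (n%:R ^+ j) (C *+ _) (expR (- c * n%:R)) (_^-1) => A1 A2 A3 A4; ring.
- exact: cvg_cst.
- apply: cvg_EFin; first exact: nearW.
  rewrite -[X in _ --> X](mulr0 K); apply: cvgM; first exact: cvg_cst.
  exact: cvg_natX_expR.
Unshelve. all: by end_near. Qed.

End FiniteClusters.

Theorem proposition1p2 (R : realType) (d : nat) (hd : (2 <= d)%N)
    (disp : measure_display) (T : measurableType disp) (P : probability T R)
    (W : ('rV[R]_d -> R) -> T -> R) (hW : white_noise P W)
    (q : 'rV[R]_d -> R) (f : T -> 'rV[R]_d -> R)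
    (hf : moving_average P W q f)
    (k : nat) (beta : R) (hA : assumptionA k beta q)
    (lc : R) (hlc : critical_level P f lc) (hlc2 : d = 2%N -> lc = 0) :
  (forall l : R, l < - lc -> superpolynomial_decay P f l) /\
  (d = 2%N -> forall l : R, l < lc -> superpolynomial_decay P f l).
Proof.
have decay l : l < - lc -> superpolynomial_decay P f l.
  (* The level [-l] lies above [lc], where the subcritical exponential bound holds. *)
  rewrite ltrNr => lcl; have [C [c [C0 c0 sub]]] := hlc.1 _ lcl.
  exact (subcritical_superpolynomial_decay hd hW hf C0 c0 sub).
split=> // dE l llc; apply: decay.
(* In the plane [lc = 0], so [- lc] and [lc] coincide. *)
by rewrite hlc2// oppr0 -(hlc2 dE).
Qed.
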